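(* Let $I\subseteq S=K[x_1,\ldots,x_n]$ be a lexsegment ideal. Then $S/I$ satisfies the Stanley conjecture, that is, $\operatorname{sdepth}(S/I)\geq \operatorname{depth}(S/I)$, where $\operatorname{sdepth}(S/I)$ is the Stanley depth of $S/I$.
   Context: $K$ is a field, $S=K[x_1,\ldots,x_n]$, and monomials of $S$ are ordered by the lexicographical order $\geq_{lex}$ induced by $x_1>x_2>\cdots>x_n$. Let $d\geq 2$ be an integer and $\mathcal{M}_d$ the set of monomials of degree $d$ of $S$. For $u,v\in\mathcal{M}_d$ with $u\geq_{lex}v$, the lexsegment set is $L(u,v)=\{w\in\mathcal{M}_d : u\geq_{lex}w\geq_{lex}v\}$. A lexsegment ideal is a monomial ideal $(L(u,v))$ generated by a lexsegment set. Stanley depth: let $M$ be a finitely generated $\mathbb{Z}^n$-graded $S$-module. For a homogeneous element $m\in M$ and a subset $Z\subseteq\{x_1,\ldots,x_n\}$, $mK[Z]$ denotes the $K$-subspace of $M$ generated by all $mw$ with $w$ a monomial in $K[Z]$; it is called a Stanley space of dimension $|Z|$ if it is a free $K[Z]$-module. A Stanley decomposition of $M$ is a presentation of $M$ as a finite direct sum (as $K$-vector space) $M=\bigoplus_{i=1}^r m_iK[Z_i]$ of Stanley spaces; its Stanley depth is $\min_i|Z_i|$. The Stanley depth $\operatorname{sdepth}(M)$ is the maximum of the Stanley depths of all Stanley decompositions of $M$. $\operatorname{depth}(S/I)$ is the depth with respect to the graded maximal ideal $(x_1,\ldots,x_n)$. *)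

(* Defs.v *)
From HB Require Import structures.
From mathcomp Require Import all_boot all_order all_algebra.
From mathcomp Require Import boolp.
From mathcomp Require Export mpoly.
From Stdlib Require ClassicalEpsilon.

Set Implicit Arguments.
Unset Strict Implicit.
Unset Printing Implicit Defensive.

Import GRing.Theory.
Local Open Scope ring_scope.
Local Open Scope quotient_scope.

Definition is_greatest (P : nat -> Prop) (m : nat) : Prop :=
  P m /\ forall k : nat, P k -> (k <= m)%N.

(* The maximum of a set of natural numbers; nothing can be proved about its
   value unless the maximum exists, see nat_maxP. *)
Definition nat_max (P : nat -> Prop) : nat :=
  ClassicalEpsilon.epsilon (inhabits 0%N) (is_greatest P).

Lemma nat_maxP (P : nat -> Prop) (b : nat) :
  (exists k, P k) -> (forall k, P k -> (k <= b)%N) ->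
  is_greatest P (nat_max P).
Proof.
move=> [k Pk] leb; apply: ClassicalEpsilon.epsilon_spec.
have ex : exists k, `[< P k >] by exists k; apply/asboolP.
have ub j : `[< P j >] -> (j <= b)%N by move/asboolP; exact: leb.
case: (ex_maxnP ex ub) => m /asboolP Pm mmax; exists m; split => // j Pj.
exact/mmax/asboolP.
Qed.

Section IdealQuotient.
Variables (R : comNzRingType) (G : R -> Prop).

Definition in_ideal (f : R) : Prop :=
  exists (r : nat) (h g : 'I_r -> R),
    (forall i, G (g i)) /\ f = \sum_(i < r) h i * g i.

Definition ideal_of : {pred R} := fun f => `[< in_ideal f >].

Lemma in_ideal0 : in_ideal 0.
Proof. by exists 0%N, (fun=> 0), (fun=> 0); split=> [[]|]; rewrite ?big_ord0. Qed.

Lemma in_idealD f1 f2 : in_ideal f1 -> in_ideal f2 -> in_ideal (f1 + f2).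
Proof.
move=> [r1 [h1 [g1 [G1 ->]]]] [r2 [h2 [g2 [G2 ->]]]].
pose sum T (a1 : 'I_r1 -> T) (a2 : 'I_r2 -> T) (i : 'I_(r1 + r2)) :=
  match split i with inl j => a1 j | inr j => a2 j end.
exists (r1 + r2)%N, (sum _ h1 h2), (sum _ g1 g2); split.
  by move=> i; rewrite /sum; case: (split i).
rewrite big_split_ord /=; congr (_ + _); apply: eq_bigr => i _.
  by rewrite /sum (unsplitK (inl i)).
by rewrite /sum (unsplitK (inr i)).
Qed.

Lemma in_idealM a f : in_ideal f -> in_ideal (a * f).
Proof.
move=> [r [h [g [Gg ->]]]]; exists r, (fun i => a * h i), g; split=> //.
by rewrite mulr_sumr; apply: eq_bigr => i _; rewrite mulrA.
Qed.

Lemma ideal_of_zmod_closed : zmod_closed ideal_of.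
Proof.
split=> [|f1 f2 /asboolP I1 /asboolP I2]; apply/asboolP; first exact: in_ideal0.
by apply: in_idealD => //; rewrite -mulN1r; apply: in_idealM.
Qed.

HB.instance Definition _ := GRing.isZmodClosed.Build R ideal_of
  ideal_of_zmod_closed.

(* Not {ideal_quot _}, which requires a proper ideal and does not provide
   the structure of an R-module. *)
Definition quot_mod : Type := Quotient.quot ideal_of.
HB.instance Definition _ := GRing.Zmodule.on quot_mod.

Definition quot_proj (f : R) : quot_mod := \pi_(Quotient.quot ideal_of) f.

Lemma quot_proj_eqP f1 f2 :
  quot_proj f1 = quot_proj f2 <-> in_ideal (f1 - f2).
Proof.
by split=> [/eqP|If]; [|apply/eqP]; rewrite -Quotient.idealrBE;
  [move/asboolP|apply/asboolP].
Qed.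

Lemma quot_projD : {morph quot_proj : f1 f2 / f1 + f2}.
Proof. exact: Quotient.pi_add. Qed.

Definition quot_lift (x : quot_mod) : R := repr (x : Quotient.quot ideal_of).

Lemma quot_liftK : cancel quot_lift quot_proj.
Proof. exact: reprK. Qed.

Definition quot_scale (a : R) (x : quot_mod) : quot_mod :=
  quot_proj (a * quot_lift x).

Lemma quot_scaleE a f : quot_scale a (quot_proj f) = quot_proj (a * f).
Proof.
apply/quot_proj_eqP; rewrite -mulrBr; apply/in_idealM/quot_proj_eqP.
exact: quot_liftK.
Qed.

Fact quot_scaleA a b x :
  quot_scale a (quot_scale b x) = quot_scale (a * b) x.
Proof. by rewrite -[x]quot_liftK !quot_scaleE mulrA. Qed.

Fact quot_scale1 : left_id 1 quot_scale.
Proof. by move=> x; rewrite -[x]quot_liftK quot_scaleE mul1r. Qed.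

Fact quot_scaleDr : right_distributive quot_scale +%R.
Proof.
move=> a x y; rewrite -[x]quot_liftK -[y]quot_liftK.
by rewrite -quot_projD !quot_scaleE mulrDr quot_projD.
Qed.

Fact quot_scaleDl x : {morph quot_scale^~ x : a b / a + b}.
Proof.
by move=> a b; rewrite -[x]quot_liftK !quot_scaleE mulrDl quot_projD.
Qed.

HB.instance Definition _ := GRing.Zmodule_isLmodule.Build R quot_mod
  quot_scaleA quot_scale1 quot_scaleDr quot_scaleDl.

Lemma quot_proj_scale a f : quot_proj (a * f) = a *: quot_proj f.
Proof. by rewrite -quot_scaleE. Qed.

End IdealQuotient.

Section Depth.
Variables (R : comNzRingType) (M : lmodType R).

(* membership in the submodule (s_0, ..., s_(r-1)) M *)
Definition in_seq_mod (s : seq R) (x : M) : Prop :=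
  exists y : 'I_(size s) -> M, x = \sum_(i < size s) s`_i *: y i.

Definition regular_seq (s : seq R) : Prop :=
  (forall (i : nat) (x : M), (i < size s)%N ->
     in_seq_mod (take i s) (s`_i *: x) -> in_seq_mod (take i s) x)
  /\ exists x : M, ~ in_seq_mod s x.

Definition depth_wrt (m : R -> Prop) : nat :=
  nat_max (fun r => exists s : seq R,
    [/\ size s = r, forall f, f \in s -> m f & regular_seq s]).

End Depth.

Section Multigraded.
Variables (K : fieldType) (n : nat).

Definition graded_max_ideal : {mpoly K[n]} -> Prop :=
  in_ideal (fun f => exists i : 'I_n, f = 'X_i).

Definition depth (M : lmodType {mpoly K[n]}) : nat :=
  depth_wrt M graded_max_ideal.

(* the subring K[Z] of K[x_1, ..., x_n] *)
Definition in_subpoly (Z : {set 'I_n}) (f : {mpoly K[n]}) : Prop :=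
  forall a : 'X_{1..n}, a \in msupp f -> forall i, i \notin Z -> a i = 0%N.

Section StanleyDepth.
(* gr b x : x belongs to the component of degree b of the Z^n-graded M *)
Variables (M : lmodType {mpoly K[n]}) (gr : ('I_n -> int) -> M -> Prop).

Definition in_mKZ (m : M) (Z : {set 'I_n}) (x : M) : Prop :=
  exists f : {mpoly K[n]}, in_subpoly Z f /\ x = f *: m.

(* m K[Z] is free over K[Z] with basis m; in particular m != 0 *)
Definition stanley_space (m : M) (Z : {set 'I_n}) : Prop :=
  (exists b, gr b m) /\
  forall f : {mpoly K[n]}, in_subpoly Z f -> f *: m = 0 -> f = 0.

Definition stanley_decomposition (r : nat)
    (m : 'I_r -> M) (Z : 'I_r -> {set 'I_n}) : Prop :=
  (forall i, stanley_space (m i) (Z i)) /\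
  forall x : M, exists! y : {ffun 'I_r -> M},
    (forall i, in_mKZ (m i) (Z i) (y i)) /\ x = \sum_(i < r) y i.

(* n only bounds the #|Z i|: this is their minimum when 0 < r, and r = 0
   can only occur for M = 0. *)
Definition stanley_decomposition_depth (r : nat) (Z : 'I_r -> {set 'I_n}) :
  nat := \big[minn/n]_(i < r) #|Z i|.

Definition sdepth : nat :=
  nat_max (fun s => exists (r : nat) (m : 'I_r -> M) (Z : 'I_r -> {set 'I_n}),
    stanley_decomposition m Z /\ stanley_decomposition_depth Z = s).

End StanleyDepth.

(* The Z^n-grading of S/(G), for G a set of monomials: in S the component of
   degree b is K x^b, and 0 if some b i is negative. *)
Definition quot_gr (G : {mpoly K[n]} -> Prop) (b : 'I_n -> int)
    (x : quot_mod G) : Prop :=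
  exists f : {mpoly K[n]}, x = quot_proj G f /\
    forall a : 'X_{1..n}, a \in msupp f -> forall i, b i = (a i)%:Z.

(* a >=_lex b for x_1 > ... > x_n; the order of the library on 'X_{1..n}
   compares total degrees first. *)
Definition lex_ge (a b : 'X_{1..n}) : Prop :=
  a = b \/ exists i : 'I_n,
    (forall j : 'I_n, (j < i)%N -> a j = b j) /\ (b i < a i)%N.

(* the set L(u, v) of monomials of degree d, as a set of polynomials *)
Definition lexsegment (d : nat) (u v : 'X_{1..n}) (f : {mpoly K[n]}) : Prop :=
  exists w : 'X_{1..n}, [/\ mdeg w = d, lex_ge u w, lex_ge w v & f = 'X_[w]].

End Multigraded.

Arguments sdepth {K n} M gr.
Arguments quot_gr {K n} G b x.
Arguments lexsegment K {n} d u v f.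

(* Main.v *)
Require Import Defs.
From mathcomp Require Import all_boot all_algebra.
From mathcomp Require Import boolp zify.

(** Why the theorem is true.

    For a monomial ideal I, both invariants of S/I can be estimated by the same
    number.  If a monomial x^w outside I is killed in S/I by the variables x_i
    with i in Y, then depth (S/I) <= n - |Y| ([depth_le]).  If the monomials
    outside I are partitioned into finitely many boxes c + N^Z, each with
    |Z| >= t, then sdepth (S/I) >= t ([sdepth_ge]): the box c + N^Z spans the
    Stanley space x^c K[Z].  So it is enough to find, for each lexsegment ideal,
    a monomial x^w with a set Y and a partition into boxes of dimension at least
    n - |Y|; this is the predicate [depth_matched].

    Depth.  Let f_1, ..., f_r be a regular sequence in (x_1, ..., x_n) with
    r > n - |Y|.  Modulo the variables in Y these are more than n - |Y|
    polynomials in n - |Y| variables, so a nontrivial polynomial relation between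
    them annihilates x^w in S/I ([exists_relation]; a dimension count).  Solving
    the relation for its lowest term, the weak regularity of the sequence puts
    the class of x^w in (f_1, ..., f_r) S/I ([relation_lowest_term]).  Powers of a
    regular sequence are still weakly regular ([weakly_regular_exp]), so the same
    holds for f_1^k, ..., f_r^k, which lie in the k-th power of the maximal ideal;
    for k > deg x^w this says that x^w is in I, a contradiction.

    Boxes.  Membership of x^a in I depends only on the exponents a_i truncated at
    a large bound B, and not at all on a_i for i in the set F of variables that
    divide no generator; cutting at B gives boxes of dimension at least |F|
    ([stable_box_partition]).  A set that is moreover closed under multiplication
    by one more variable has boxes of dimension at least |F| + 1
    ([stable_up_box_partition]).

    Lexsegments.  A common factor x_i of all generators can be divided out, because
    S/(x_i J) is the direct sum of S/(x_i) and x_i (S/J), where S/(x_i) is a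
    polynomial ring in n - 1 variables ([depth_matched_shift]).  This leaves the
    ideals generated by one variable and the case where, for some q, the generators
    involve only x_q, ..., x_n, and x_q divides u but not v.
    Put r = q + 1 and let d be the degree of u minus 1.

    If x_n u/x_q >= v, then u/x_q is killed by x_q, ..., x_n, and the remaining
    q - 1 variables divide no generator.  Otherwise x_q divides u exactly once,
    and the monomials outside I split into those that stay outside after
    multiplication by x_q, a set on which x_q acts freely, and the others, a set
    closed under multiplication by x_n ([segment_notin_mul_last]).  So boxes of
    dimension |F| + 1 exist for every set F of variables other than x_q, x_n
    that divide no generator ([segment_box_partition]).  It remains to exhibit
    monomials whose annihilator is as large as this allows: 1 if d = 0, else u/x_r
    if x_r divides u, else x_q x_r^d if x_r^d x_n >= v, else
    x_q x_r^d x_n^(d-1), in which last case v = x_r^d x_j with j < n. *)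

Set Implicit Arguments.
Unset Strict Implicit.
Unset Printing Implicit Defensive.

(** * Weakly regular sequences *)
Section WeaklyRegular.
Import GRing.Theory.
Local Open Scope ring_scope.
Variables (R : comNzRingType) (M : lmodType R).
Implicit Types (N : M -> Prop) (f g : R) (s : seq R) (x y z : M).

Definition submodule N : Prop :=
  [/\ N 0, forall x y, N x -> N y -> N (x + y) & forall a x, N x -> N (a *: x)].

Definition add_mul N f : M -> Prop := fun x => exists y z, N y /\ x = y + f *: z.

(** The sequence s is weakly regular on M/N.  Enlarging the submodule N takes the
    place of passing to quotient modules, so that inductions on s stay inside the
    single module M. *)
Fixpoint weakly_regular N s : Prop :=
  if s is f :: s' then
    (forall x, N (f *: x) -> N x) /\ weakly_regular (add_mul N f) s'
  else True.

Fixpoint add_seq_mul N s : M -> Prop :=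
  if s is f :: s' then add_seq_mul (add_mul N f) s' else N.

Lemma submoduleB N x y : submodule N -> N x -> N y -> N (x - y).
Proof. by case=> _ ND NZ Nx Ny; apply: ND => //; rewrite -scaleN1r; apply: NZ. Qed.

Lemma submodule_add_mul N f : submodule N -> submodule (add_mul N f).
Proof.
case=> N0 ND NZ; split.
- by exists 0, 0; rewrite scaler0 addr0.
- move=> _ _ [y1 [z1 [Ny1 ->]]] [y2 [z2 [Ny2 ->]]].
  by exists (y1 + y2), (z1 + z2); split; [exact: ND | rewrite scalerDr addrACA].
- move=> a _ [y [z [Ny ->]]]; exists (a *: y), (a *: z); split; first exact: NZ.
  by rewrite scalerDr !scalerA mulrC.
Qed.

Lemma sub_add_mul N f x : N x -> add_mul N f x.
Proof. by move=> Nx; exists x, 0; rewrite scaler0 addr0. Qed.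

Lemma weakly_regular_ext N N' s :
  (forall x, N x <-> N' x) -> weakly_regular N s -> weakly_regular N' s.
Proof. by move=> NN'; have -> : N = N' by apply/funext => x; apply/propext. Qed.

(** Weak regularity on both ends of the exact sequence
    0 -> M/N1 -> M/N -> M/N2 -> 0, with multiplication by f as its first map,
    gives weak regularity in the middle.  The hypotheses on N1 and N2 say that the
    sequence is exact, and exactness survives dividing out by the head of s, as
    this head is regular on M/N2. *)
Lemma weakly_regular_exact N N1 N2 f s :
  submodule N -> (forall x, N1 x <-> N (f *: x)) ->
  (forall x, N2 x <-> add_mul N f x) ->
  weakly_regular N1 s -> weakly_regular N2 s -> weakly_regular N s.
Proof.
elim: s N N1 N2 => //= h s IH N N1 N2 subN N1E N2E [reg1 wr1] [reg2 wr2].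
have [N0 ND NZ] := subN.
split=> [x Nhx|].
  have /N2E[y [z [Ny Dx]]] : N2 x by apply/reg2/N2E/sub_add_mul.
  rewrite Dx; apply: ND => //; apply/N1E/reg1/N1E.
  have -> : f *: (h *: z) = h *: x - h *: y.
    by rewrite Dx scalerDr addrC addKr !scalerA mulrC.
  by apply: submoduleB => //; apply: NZ.
apply: IH wr1 wr2; first exact: submodule_add_mul.
- move=> x; split=> [[y [z [/N1E Ny ->]]]|[y [z [Ny Dx]]]].
    by exists (f *: y), (f *: z); rewrite scalerDr !scalerA mulrC.
  have /N2E[y' [z' [Ny' Dz]]] : N2 z.
    apply/reg2/N2E; exists (- y), x; split; first by rewrite -scaleN1r; apply: NZ.
    by rewrite Dx addKr.
  exists (x - h *: z'), z'; split; last by rewrite subrK.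
  apply/N1E; rewrite scalerBr Dx Dz scalerDr !scalerA [f * h]mulrC addrA addrK.
  by apply: ND => //; apply: NZ.
- move=> x; split=> [[y [z [/N2E[y' [z' [Ny' ->]]] ->]]]|].
    exists (y' + h *: z), z'; split; last by rewrite addrAC.
    by exists y', z.
  case=> _ [z [[y' [z' [Ny' ->]]] ->]]; exists (y' + f *: z), z'.
  by split; [apply/N2E; exists y', z | rewrite addrAC].
Qed.

(** The previous lemma for 0 -> M/gM -> M/fgM -> M/fM -> 0. *)
Lemma weakly_regular_mul_head N f g s : submodule N ->
  weakly_regular N (f :: s) -> weakly_regular N (g :: s) ->
  weakly_regular N (f * g :: s).
Proof.
move=> subN [/= regf wrf] [regg wrg]; split=> [x|].
  by rewrite -scalerA => /regf/regg.
have [N0 ND NZ] := subN.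
apply: (weakly_regular_exact _ _ _ wrg wrf); first exact: submodule_add_mul.
- move=> x; split=> [[y [z [Ny ->]]]|[y [z [Ny Dx]]]].
    exists (f *: y), z; split; first exact: NZ.
    by rewrite scalerDr scalerA.
  exists (x - g *: z), z; split; last by rewrite subrK.
  by apply: regf; rewrite scalerBr Dx scalerA addrK.
- move=> x; split=> [[y [z [Ny ->]]]|[_ [z [[y [z' [Ny ->]]] ->]]]].
    by exists y, z; split=> //; apply: sub_add_mul.
  exists y, (g *: z' + z); split=> //.
  by rewrite scalerDr scalerA addrA.
Qed.

Lemma weakly_regular_exp N s k : submodule N ->
  weakly_regular N s -> weakly_regular N [seq f ^+ k.+1 | f <- s].
Proof.
elim: s N => //= f s IH N subN wr.
have [reg wr'] : weakly_regular N (f ^+ k.+1 :: s).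
  by elim: k {IH} => [|k IHk]; rewrite ?expr1 // exprS; apply: weakly_regular_mul_head.
by split=> //; apply: IH => //; apply: submodule_add_mul.
Qed.

Lemma in_seq_mod_submodule s : submodule (in_seq_mod (M := M) s).
Proof.
split.
- by exists (fun=> 0); rewrite big1 // => i _; rewrite scaler0.
- move=> _ _ [y ->] [z ->]; exists (fun i => y i + z i).
  by rewrite -big_split; apply: eq_bigr => i _; rewrite scalerDr.
- move=> a _ [y ->]; exists (fun i => a *: y i).
  by rewrite scaler_sumr; apply: eq_bigr => i _; rewrite !scalerA mulrC.
Qed.

Lemma in_seq_mod_rcons s f x :
  in_seq_mod (rcons s f) x <-> add_mul (in_seq_mod s) f x.
Proof.
have szr : size (rcons s f) = (size s).+1 by rewrite size_rcons.
split=> [[y ->]|[_ [z [[y ->] ->]]]].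
  pose y' := y \o cast_ord (esym szr).
  exists (\sum_(i < size s) s`_i *: y' (widen_ord (leqnSn _) i)), (y' ord_max).
  split; first by eexists.
  rewrite (reindex (cast_ord (esym szr))) /=; last first.
    by exists (cast_ord szr) => i _; rewrite ?cast_ordK ?cast_ordKV.
  rewrite big_ord_recr /= nth_rcons ltnn eqxx; congr (_ + _).
  by apply: eq_bigr => i _; rewrite nth_rcons ltn_ord.
pose y' (i : 'I_(size s).+1) := if unlift ord_max i is Some j then y j else z.
exists (y' \o cast_ord szr); rewrite (reindex (cast_ord (esym szr))) /=; last first.
  by exists (cast_ord szr) => i _; rewrite ?cast_ordK ?cast_ordKV.
rewrite big_ord_recr /= nth_rcons ltnn eqxx cast_ordKV /y' unlift_none.
congr (_ + _); apply: eq_bigr => i _; rewrite nth_rcons ltn_ord cast_ordKV.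
have -> : widen_ord (leqnSn _) i = lift ord_max i.
  by apply: val_inj; rewrite /= /bump leqNgt ltn_ord.
by rewrite liftK.
Qed.

Lemma regular_seq_weakly_regular s :
  regular_seq M s -> weakly_regular (in_seq_mod (M := M) [::]) s.
Proof.
case=> reg _; rewrite -[s]cat0s in reg; elim: s [::] reg => //= f s IH p reg.
split=> [x Nfx|].
  have := reg (size p) x; rewrite take_size_cat // nth_cat ltnn subnn /=.
  by apply=> //; rewrite size_cat /= -addn1 leq_add2l.
apply: (weakly_regular_ext (in_seq_mod_rcons p f)); apply: IH.
by rewrite cat_rcons.
Qed.

End WeaklyRegular.

(** * Algebraic relations between polynomials *)
Section AlgebraicRelation.
Import GRing.Theory.
Local Open Scope ring_scope.
Variables (K : fieldType) (n : nat).
Implicit Types (f : {mpoly K[n]}) (s : seq {mpoly K[n]}) (c : seq nat -> K).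

(** The value at s of the polynomial whose coefficients are c and whose exponents
    are all less than B.  The nested form isolates the first element of s, the one
    that the induction of [relation_lowest_term] removes. *)
Fixpoint relation B c s : {mpoly K[n]} :=
  if s is f :: s' then
    \sum_(j < B) f ^+ j * relation B (fun l => c (nat_of_ord j :: l)) s'
  else (c [::])%:MP.

Fixpoint exponents B r : seq (seq nat) :=
  if r is r'.+1 then [seq j :: l | j <- iota 0 B, l <- exponents B r']
  else [:: [::]].

Fixpoint power_product s (l : seq nat) : {mpoly K[n]} :=
  match s, l with
  | f :: s', j :: l' => f ^+ j * power_product s' l'
  | _, _ => 1
  end.

Lemma mem_exponents B r l :
  (l \in exponents B r) = (size l == r) && all (fun j => j < B)%N l.
Proof.
elim: r l => [|r IH] l /=; first by case: l.
apply/allpairsP/idP => [[[j l'] /= [jB]]|].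
  rewrite mem_iota /= in jB; rewrite IH => /andP[/eqP<- l'B] -> /=.
  by rewrite eqxx jB.
case: l => //= j l /andP[szl /andP[jB lB]]; exists (j, l).
by rewrite mem_iota add0n jB IH -eqSS szl lB.
Qed.

Lemma size_exponents B r : size (exponents B r) = (B ^ r)%N.
Proof. by elim: r => //= r IH; rewrite size_allpairs size_iota IH expnS. Qed.

Lemma exponents_uniq B r : uniq (exponents B r).
Proof.
elim: r => //= r IH; apply: allpairs_uniq => //; first exact: iota_uniq.
by move=> [j l] [j' l'] _ _ /= [-> ->].
Qed.

Lemma relationE B c s :
  relation B c s = \sum_(l <- exponents B (size s)) c l *: power_product s l.
Proof.
elim: s c => [|f s IH] c /=; first by rewrite big_seq1 -alg_mpolyC.
rewrite big_allpairs_dep -[X in iota _ X]subn0 -/(index_iota 0 B) big_mkord.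
apply: eq_bigr => j _; rewrite IH mulr_sumr; apply: eq_bigr => l _.
by rewrite scalerAr.
Qed.

(** With j0 the lowest exponent of the head f, the relation is
    f^j0 (E_j0 + f * rest).  Regularity cancels f^j0, so E_j0 annihilates x modulo
    N + fM, and E_j0 is a nontrivial relation between the remaining elements.  At
    the end a nonzero constant sends x into N + s M. *)
Lemma relation_lowest_term (M : lmodType {mpoly K[n]}) (N : M -> Prop)
    B c s l (x : M) :
  submodule N -> weakly_regular N s ->
  l \in exponents B (size s) -> c l != 0 ->
  N (relation B c s *: x) -> add_seq_mul N s x.
Proof.
elim: s N c l => [|f s IH] N c l subN.
  rewrite inE => _ /eqP-> c0; have [_ _ NZ] := subN.
  move/(NZ (c [::])^-1%:MP); rewrite scalerA -mpolyCM mulVf //.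
  by rewrite mpolyC1 scale1r.
move=> [regf wr] lB cl Nx.
pose P j := has (fun l' => c (j :: l') != 0) (exponents B (size s)).
have exP : exists j, P j.
  move: lB cl; rewrite mem_exponents; case: l => //= j l /andP[szl /andP[_ lB]] cl.
  by exists j; apply/hasP; exists l; rewrite // mem_exponents lB -eqSS szl.
case: (ex_minnP exP) => j0 /hasP[l' l'B cl'] j0min.
have j0B : (j0 < B)%N.
  rewrite ltnNge; apply/negP => Bj0.
  move: lB cl; rewrite mem_exponents; case: l => //= j l /andP[szl /andP[jB lB]] cl.
  suff /j0min : P j by rewrite leqNgt (leq_trans jB).
  by apply/hasP; exists l; rewrite // mem_exponents lB -eqSS szl.
pose E j := relation B (fun l => c (j :: l)) s.
have E0 j : (j < j0)%N -> E j = 0.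
  move=> jj0; rewrite /E relationE big_seq big1 // => l1 l1B.
  have [-> |cl1] := eqVneq (c (j :: l1)) 0; first by rewrite scale0r.
  suff /j0min : P j by rewrite leqNgt jj0.
  by apply/hasP; exists l1.
pose rest : {mpoly K[n]} :=
  \sum_(j < B | j != Ordinal j0B) f ^+ (j - j0.+1) * E j.
have relE : relation B c (f :: s) = f ^+ j0 * (E j0 + f * rest).
  rewrite /= (bigD1 (Ordinal j0B)) //= mulrDr; congr (_ + _).
  rewrite !mulr_sumr; apply: eq_bigr => j; rewrite -val_eqE /= neq_ltn.
  case/orP=> [/E0 Ej|j0j]; first by rewrite -/(E j) Ej !mulr0.
  by rewrite !mulrA -exprSr -exprD subnKC.
have regk k y : N (f ^+ k *: y) -> N y.
  elim: k => [|k IHk]; first by rewrite expr0 scale1r.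
  by rewrite exprS -scalerA => /regf/IHk.
move: Nx; rewrite relE -scalerA => /regk; rewrite scalerDl => Nx.
apply: IH l'B cl' _ => //; first exact: submodule_add_mul.
exists ((E j0) *: x + (f * rest) *: x), (- (rest *: x)); split=> //.
by rewrite scalerN scalerA addrK.
Qed.

Definition degree_le e f := forall a, a \in msupp f -> (mdeg a <= e)%N.

Lemma degree_leM e1 e2 f1 f2 :
  degree_le e1 f1 -> degree_le e2 f2 -> degree_le (e1 + e2) (f1 * f2).
Proof.
move=> le1 le2 a /msuppM_le/allpairsP[[a1 a2] /= [/le1 a1e /le2 a2e ->]].
by rewrite mdegD leq_add.
Qed.

Lemma degree_le1 : degree_le 0 1.
Proof. by move=> a; rewrite -mpolyC1 msuppC oner_eq0 inE => /eqP->; rewrite mdeg0. Qed.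

Lemma degree_leX e f k : degree_le e f -> degree_le (k * e) (f ^+ k).
Proof.
move=> le; elim: k => [|k IH]; first by rewrite expr0; exact: degree_le1.
by rewrite exprS mulSn; apply: degree_leM.
Qed.

Lemma degree_le_power_product e B s l :
  (forall f, f \in s -> degree_le e f) -> l \in exponents B (size s) ->
  degree_le (size s * (B * e)) (power_product s l).
Proof.
rewrite mem_exponents.
elim: s l => [|f s IH] [|j l] //= le => [_|]; first exact: degree_le1.
rewrite eqSS => /andP[szl /andP[jB lB]]; rewrite mulSn.
apply: degree_leM; last first.
  by apply: IH; rewrite ?szl // => g gs; apply: le; rewrite inE gs orbT.
move=> a /(degree_leX (le f (mem_head _ _))) /leq_trans; apply.
by rewrite leq_mul2r ltnW ?orbT.
Qed.

(** The products of powers with exponents less than B number B^r, where r is the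
    length of s.  Restricted to the monomials in the variables of Z, they lie in a
    space of dimension at most (r B e + 1)^|Z|, where e bounds the degrees in s.
    Since |Z| < r, the first number exceeds the second for large B. *)
Lemma exists_relation (Z : {set 'I_n}) s : (#|Z| < size s)%N ->
  exists B c l, [/\ l \in exponents B (size s), c l != 0 &
    forall a : 'X_{1..n}, (forall i, i \notin Z -> a i = 0%N) -> (relation B c s)@_a = 0].
Proof.
move=> Zs; set r := size s in Zs *.
pose e := (\max_(f <- s) msize f)%N.
have le_e f : f \in s -> degree_le e f.
  move=> fs a /msize_mdeg_lt/ltnW/leq_trans; apply.
  by rewrite /e (big_rem f) //= leq_maxl.
pose B := ((r * e).+1 ^ #|Z|).+1; pose D := (r * (B * e)).+1.
pose T : finType := {ffun {i | i \in Z} -> 'I_D}.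
have ltTB : (#|T| < B ^ r)%N.
  rewrite card_ffun card_ord card_sig.
  have -> : #|[pred x in Z]| = #|Z| by apply: eq_card.
  have B0 : (0 < B)%N by [].
  have leD : (D <= B * (r * e).+1)%N by rewrite /D mulnS [(r * _)%N]mulnCA -addn1 addnC leq_add2r.
  apply: (@leq_ltn_trans (B ^ #|Z| * (r * e).+1 ^ #|Z|)%N).
    rewrite -expnMn; case: #|Z| => // t; by rewrite leq_exp2r.
  apply: (@leq_trans (B ^ #|Z| * B)%N); first by rewrite ltn_pmul2l ?expn_gt0.
  by rewrite -expnSr leq_exp2l // ltnS expn_gt0.
pose mnmT (phi : T) : 'X_{1..n} :=
  [multinom (if insub i is Some z then val (phi z) else 0%N) | i < n].
pose ls := exponents B r.
pose A : 'M[K]_(size ls, #|T|) :=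
  \matrix_(k, j) (power_product s (nth [::] ls k))@_(mnmT (enum_val j)).
have kerA : kermx A != 0.
  rewrite -mxrank_eq0 mxrank_ker -lt0n subn_gt0.
  by rewrite (leq_ltn_trans (rank_leq_col A)) // size_exponents.
case/rowV0Pn: kerA => v /sub_kermxP vA /rV0Pn[k vk].
pose c l := if insub (index l ls) is Some k then v 0 k else 0.
have cE (j : 'I_(size ls)) : c (nth [::] ls j) = v 0 j.
  by rewrite /c index_uniq ?exponents_uniq // valK.
(* A coefficient at an exponent with some a_i >= D vanishes because D exceeds the
   degree of all products; the others supported in Z index the columns of A. *)
exists B, c, (nth [::] ls k); split; rewrite ?cE ?mem_nth // => a aZ.
rewrite relationE (raddf_sum (mcoeff a)) /=.
have [/forallP aD|] := boolP [forall i, a i < D]%N; last first.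
  case/forallPn=> i; rewrite -leqNgt => Dai.
  rewrite big_seq big1 // => l lB; rewrite mcoeffZ memN_msupp_eq0 ?mulr0 //.
  apply/negP => /(degree_le_power_product le_e lB); apply/negP.
  by rewrite -ltnNge (leq_trans Dai) // mdegE (bigD1 i) //= leq_addr.
pose phi : T := [ffun z => Ordinal (aD (val z))].
have aE : a = mnmT (enum_val (enum_rank phi)).
  apply/mnmP => i; rewrite mnmE enum_rankK.
  case: insubP => [z _ <-|/aZ //]; first by rewrite ffunE.
have := congr1 (fun w : 'rV_#|T| => w 0 (enum_rank phi)) vA; rewrite !mxE; apply: etrans.
rewrite (big_nth [::]) big_mkord; apply: eq_bigr => j _.
by rewrite mcoeffZ cE mxE -aE.
Qed.

End AlgebraicRelation.

(** * The depth of a quotient by a monomial ideal *)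
Section MonomialIdeal.
Import GRing.Theory.
Local Open Scope ring_scope.
Variables (K : fieldType) (n : nat).
Variables (L : 'X_{1..n} -> Prop) (G : {mpoly K[n]} -> Prop).
Hypothesis GE : forall f, G f <-> exists2 g, L g & f = 'X_[g].

Definition divisible (L : 'X_{1..n} -> Prop) (a : 'X_{1..n}) : Prop :=
  exists2 g, L g & (g <= a)%MM.

Lemma divisible_trans a b : divisible L a -> (a <= b)%MM -> divisible L b.
Proof. by move=> [g Lg ga] ab; exists g => //; apply: lepm_trans ab. Qed.

Lemma in_ideal_gen (g : 'X_{1..n}) : L g -> in_ideal G 'X_[g].
Proof.
move=> Lg; exists 1%N, (fun=> 1), (fun=> 'X_[g]); split.
  by move=> _; apply/GE; exists g.
by rewrite big_ord1 mul1r.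
Qed.

Lemma in_ideal_msupp (f : {mpoly K[n]}) :
  in_ideal G f <-> forall a, a \in msupp f -> divisible L a.
Proof.
split=> [[r [h [g [Gg ->]]]] a|fL].
  move/msupp_sum_le/flatten_mapP => [i _ /msuppM_le/allpairsP[[a1 a2] /= [_ + ->]]].
  case/GE: (Gg i) => m Lm -> /mem_msuppXP <-.
  by exists m => //; apply: lem_addl.
rewrite [f]mpolyE big_seq; apply: big_ind => [||a /fL[g Lg ga]].
- exact: in_ideal0.
- exact: in_idealD.
- rewrite -(submK ga) mpolyXD scalerAl.
  exact/in_idealM/in_ideal_gen.
Qed.

Lemma quot_proj0 f : quot_proj G f = 0 <-> forall a, a \in msupp f -> divisible L a.
Proof.
have -> : 0 = quot_proj G 0 by rewrite -[in RHS](mul0r 0) quot_proj_scale scale0r.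
by rewrite quot_proj_eqP subr0; apply: in_ideal_msupp.
Qed.

Definition order_gt k (f : {mpoly K[n]}) := forall a, a \in msupp f -> (k < mdeg a)%N.

Lemma order_gt_pow_maximal (f : {mpoly K[n]}) k :
  graded_max_ideal f -> order_gt k (f ^+ k.+1).
Proof.
move=> [r [h [g [gX Df]]]].
have f0 a : a \in msupp f -> (0 < mdeg a)%N.
  rewrite Df => /msupp_sum_le/flatten_mapP[i _ /msuppM_le/allpairsP[[a1 a2] /= [_ + ->]]].
  case: (gX i) => j -> /mem_msuppXP <-.
  by rewrite mdegD mdeg1 addn1.
elim: k => [|k IH] a; first by rewrite expr1 => /f0.
rewrite exprS => /msuppM_le/allpairsP[[a1 a2] /= [/f0 a1f /IH a2f ->]].
by rewrite mdegD -addn1 addnC leq_add.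
Qed.

Lemma order_gtM k (f g : {mpoly K[n]}) : order_gt k f -> order_gt k (f * g).
Proof.
move=> fk a /msuppM_le/allpairsP[[a1 a2] /= [/fk a1k _ ->]].
by rewrite mdegD ltn_addr.
Qed.

(** In the application H is the image of the polynomials without terms of low
    degree. *)
Lemma add_seq_mul_sub (M : lmodType {mpoly K[n]}) (N H : M -> Prop) s x :
  (forall y, N y -> H y) -> (forall y z, H y -> H z -> H (y + z)) ->
  (forall f y, f \in s -> H (f *: y)) -> add_seq_mul N s x -> H x.
Proof.
move=> NH HD; elim: s N NH => [|f s IH] N NH sH /=; first exact: NH.
apply: IH => [_ [y [z [/NH Hy ->]]]|g y gs].
  by apply: HD => //; apply: sH; rewrite inE eqxx.
by apply: sH; rewrite inE gs orbT.
Qed.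

Lemma regular_seq_size_le (w : 'X_{1..n}) (Y : {set 'I_n}) s :
  ~ divisible L w -> (forall i, i \in Y -> divisible L (w + U_(i))%MM) ->
  (forall f, f \in s -> graded_max_ideal f) -> regular_seq (quot_mod G) s ->
  (size s + #|Y| <= n)%N.
Proof.
move=> wL wY sm /regular_seq_weakly_regular reg; rewrite leqNgt; apply/negP => sY.
set N := in_seq_mod [::] in reg.
have subN : submodule N by apply: in_seq_mod_submodule.
have N0 x : N x -> x = 0 by move=> [y ->]; rewrite big_ord0.
set k := mdeg w; pose s' := [seq f ^+ k.+1 | f <- s].
have reg' : weakly_regular N s' by apply: weakly_regular_exp.
have [|B [c [l [lB cl relZ]]]] := @exists_relation K n (~: Y) s'.
  by rewrite size_map -(ltn_add2r #|Y|) addnC cardsC card_ord.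
have Nrel : N (relation B c s' *: quot_proj G 'X_[w]).
  rewrite -quot_proj_scale; case: (subN) => N0' _ _.
  suff -> : quot_proj G (relation B c s' * 'X_[w]) = 0 by [].
  apply/quot_proj0 => _ /msuppM_le/allpairsP[[a b] /= [asup /mem_msuppXP<- ->]].
  have [|/forallPn[i]] := boolP [forall i, (i \in Y) ==> (a i == 0%N)].
    move/forall_inP => aY; move: asup; rewrite mcoeff_msupp relZ ?eqxx // => i.
    by rewrite inE negbK => /aY/eqP.
  rewrite negb_imply => /andP[/wY wi ai]; apply: (divisible_trans wi).
  apply/mnm_lepP => j; rewrite !mnmDE mnm1E addnC leq_add2r.
  by case: eqP => // <-; rewrite lt0n.
pose H (x : quot_mod G) := exists2 f, x = quot_proj G f & order_gt k f.
have [f Df fk] : H (quot_proj G 'X_[w]).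
  apply: add_seq_mul_sub (relation_lowest_term subN reg' lB cl Nrel).
  - move=> y /N0->; exists 0; last by move=> a; rewrite msupp0.
    by symmetry; apply/quot_proj0 => a; rewrite msupp0.
  - move=> _ _ [f -> fk] [g -> gk]; exists (f + g); first by rewrite quot_projD.
    by move=> a /msuppD_le; rewrite mem_cat => /orP[/fk|/gk].
  - move=> _ y /mapP[f fs ->]; exists (f ^+ k.+1 * quot_lift y).
      by rewrite quot_proj_scale quot_liftK.
    by apply/order_gtM/order_gt_pow_maximal/sm.
move/quot_proj_eqP/in_ideal_msupp: Df => /(_ w) wdiv; apply: wL; apply: wdiv.
rewrite mcoeff_msupp mcoeffB mcoeffX eqxx (memN_msupp_eq0 (m := w)) ?subr0 ?oner_eq0 //.
by apply/negP => /fk; rewrite ltnn.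
Qed.

(** The bound on the lengths of regular sequences also shows that the maximum
    defining the depth is attained; the empty sequence is regular because x^w is
    nonzero in the quotient. *)
Theorem depth_le (w : 'X_{1..n}) (Y : {set 'I_n}) :
  ~ divisible L w -> (forall i, i \in Y -> divisible L (w + U_(i))%MM) ->
  (depth (quot_mod G) + #|Y| <= n)%N.
Proof.
move=> wL wY; rewrite /depth /depth_wrt; set P := (fun r => _).
have bound r : P r -> (r + #|Y| <= n)%N.
  by move=> [s [<- sm reg]]; exact: regular_seq_size_le wL wY sm reg.
have [||Pm _] := @nat_maxP P n.
- exists 0%N, [::]; split=> //; split=> //.
  exists (quot_proj G 'X_[w]) => - [y]; rewrite big_ord0 => /quot_proj0 wdiv.
  by apply/wL/wdiv; rewrite msuppX inE.
- by move=> r /bound; apply: leq_trans; rewrite leq_addr.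
exact: bound.
Qed.

End MonomialIdeal.

(** * Stanley decompositions from boxes of monomials *)
Section StanleyDecomposition.
Import GRing.Theory.
Local Open Scope ring_scope.
Variables (K : fieldType) (n : nat).
Variables (L : 'X_{1..n} -> Prop) (G : {mpoly K[n]} -> Prop).
Hypothesis GE : forall f, G f <-> exists2 g, L g & f = 'X_[g].
Implicit Types (c a b : 'X_{1..n}) (Z : {set 'I_n}) (f h : {mpoly K[n]}).

(** The set of exponents c + N^Z. *)
Definition in_box c Z : pred 'X_{1..n} :=
  fun a => [forall i, if i \in Z then c i <= a i else a i == c i]%N.

Definition box_partition (A : 'X_{1..n} -> Prop) (t : nat) : Prop :=
  exists (I : finType) (c : I -> 'X_{1..n}) (Z : I -> {set 'I_n}),
  [/\ forall i, (t <= #|Z i|)%N,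
      forall i a, in_box (c i) (Z i) a -> A a,
      forall a, A a -> exists i, in_box (c i) (Z i) a &
      forall i j a, in_box (c i) (Z i) a -> in_box (c j) (Z j) a -> i = j].

Lemma in_boxP c Z a :
  reflect ((c <= a)%MM /\ forall i, i \notin Z -> a i = c i) (in_box c Z a).
Proof.
apply: (iffP forallP) => [ca|[/mnm_lepP ca aZ] i].
  split=> [|i iZ]; last by have := ca i; rewrite (negPf iZ) => /eqP.
  by apply/mnm_lepP => i; have := ca i; case: ifP => // _ /eqP->.
by case: ifPn => [_ //|/aZ/eqP].
Qed.

Definition restrict (P : pred 'X_{1..n}) f : {mpoly K[n]} :=
  \sum_(a <- msupp f | P a) f@_a *: 'X_[a].

Lemma mcoeff_restrict P f a : (restrict P f)@_a = if P a then f@_a else 0.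
Proof.
have off Q : ~~ Q a -> (restrict Q f)@_a = 0.
  move=> Qa; rewrite raddf_sum /= big1 // => b Qb; rewrite mcoeffZ mcoeffX.
  by case: eqP Qb => [->|]; rewrite ?(negPf Qa) // mulr0.
case: ifPn => [Pa|]; last exact: off.
rewrite {2}[f]mpolyE (bigID P) /= mcoeffD -!/(restrict _ _).
by rewrite (off (predC P)) ?addr0 //= Pa.
Qed.

Lemma restrict_box c Z f :
  exists2 h, in_subpoly Z h & restrict (in_box c Z) f = h * 'X_[c].
Proof.
exists (\sum_(a <- msupp f | in_box c Z a) f@_a *: 'X_[a - c]).
  move=> b /msupp_sum_le/flatten_mapP[a]; rewrite mem_filter => /andP[/in_boxP[_ aZ] _].
  by move/msuppZ_le/mem_msuppXP <- => i /aZ aci; rewrite mnmBE aci subnn.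
rewrite mulr_suml; apply: eq_bigr => a /in_boxP[ca _].
by rewrite -scalerAl -mpolyXD submK.
Qed.

Lemma msupp_box c Z h a :
  in_subpoly Z h -> a \in msupp (h * 'X_[c]) -> in_box c Z a.
Proof.
move=> hZ /msuppM_le/allpairsP[[b b'] /= [/hZ bZ /mem_msuppXP<- ->]].
apply/in_boxP; split=> [|i /bZ bi]; first exact: lem_addl.
by rewrite mnmDE bi.
Qed.

Lemma quot_proj_sum (I : finType) (F : I -> {mpoly K[n]}) :
  \sum_i quot_proj G (F i) = quot_proj G (\sum_i F i).
Proof.
symmetry; apply: (big_morph (quot_proj G)); first exact: quot_projD.
by apply/(quot_proj0 GE) => a; rewrite msupp0.
Qed.

(** The component of f in x^c K[Z] is the part of f supported on the box c + N^Z.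
    Freeness and uniqueness hold because no monomial of the box is in the
    ideal. *)
Lemma box_partition_stanley (r : nat) (c : 'I_r -> 'X_{1..n}) (Z : 'I_r -> {set 'I_n}) :
  (forall i a, in_box (c i) (Z i) a -> ~ divisible L a) ->
  (forall a, ~ divisible L a -> exists i, in_box (c i) (Z i) a) ->
  (forall i j a, in_box (c i) (Z i) a -> in_box (c j) (Z j) a -> i = j) ->
  stanley_decomposition (quot_gr G) (fun i => quot_proj G 'X_[c i]) Z.
Proof.
move=> boxL coverL disj; split=> [i|x].
  split=> [|f fZ f0].
    exists (fun j => (c i j)%:Z), 'X_[c i]; split=> // a.
    by move/mem_msuppXP <-.
  apply/eqP; rewrite -msupp_eq0; case Df: (msupp f) => [//|a s].
  have af : a \in msupp f by rewrite Df mem_head.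
  have acf : (a + c i)%MM \in msupp (f * 'X_[c i]).
    by rewrite mcoeff_msupp addmC mcoeffMX -mcoeff_msupp.
  case: (boxL i _ (msupp_box fZ acf)).
  by move: (a + c i)%MM acf; apply/(quot_proj0 GE); rewrite quot_proj_scale.
rewrite -[x]quot_liftK; move: (quot_lift x) => f {x}.
exists [ffun i => quot_proj G (restrict (in_box (c i) (Z i)) f)]; split.
  split=> [i|].
    have [h hZ hE] := restrict_box (c i) (Z i) f.
    by exists h; split=> //; rewrite ffunE hE quot_proj_scale.
  under eq_bigr do rewrite ffunE.
  rewrite quot_proj_sum; apply/quot_proj_eqP/(in_ideal_msupp GE) => a.
  rewrite mcoeff_msupp mcoeffB raddf_sum /= => fa.
  apply: contrapT => /coverL[i ai]; move: fa.
  rewrite (bigD1 i) //= big1 => [|j ji]; first by rewrite mcoeff_restrict ai addr0 subrr eqxx.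
  rewrite mcoeff_restrict; case: ifP => // aj.
  by rewrite (disj _ _ _ aj ai) eqxx in ji.
move=> y [yZ]; have /choice[h hE] i : exists h, in_subpoly (Z i) h /\ y i = h *: quot_proj G 'X_[c i].
  exact: yZ.
have yE i : y i = quot_proj G (h i * 'X_[c i]) by rewrite quot_proj_scale; case: (hE i).
under eq_bigr do rewrite yE.
rewrite quot_proj_sum => /quot_proj_eqP/(in_ideal_msupp GE) fy.
apply/ffunP => i; rewrite ffunE yE; congr (quot_proj G _); apply/mpolyP => a.
have hbox j : ~~ in_box (c j) (Z j) a -> (h j * 'X_[c j])@_a = 0.
  move=> aj; apply: memN_msupp_eq0; apply: contra aj; apply: msupp_box.
  by case: (hE j).
rewrite mcoeff_restrict; case: ifPn => [ai|/hbox//].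
have := contra_not (fy a) (boxL _ _ ai) => /negP.
rewrite mcoeff_msupp negbK mcoeffB raddf_sum /= (bigD1 i) //= big1 => [|j ji].
  by rewrite addr0 subr_eq0 => /eqP.
by apply: hbox; apply: contra ji => aj; rewrite (disj _ _ _ aj ai).
Qed.

(** All dimensions are at most n, so the maximum defining the Stanley depth is
    attained.  The hypothesis t <= n covers the zero module, whose empty
    decomposition has depth n. *)
Theorem sdepth_ge t : (t <= n)%N ->
  box_partition (fun a => ~ divisible L a) t ->
  (t <= sdepth (quot_mod G) (quot_gr G))%N.
Proof.
move=> tn [I [c [Z [tZ boxL coverL disj]]]].
pose Z' (i : 'I_#|I|) := Z (enum_val i).
apply: (@leq_trans (stanley_decomposition_depth Z')).
  by rewrite /stanley_decomposition_depth; elim/big_rec: _ => // i s _ ts; rewrite leq_min tZ.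
rewrite /sdepth; set P := (fun s => _).
have PZ : P (stanley_decomposition_depth Z').
  exists #|I|, (fun i => quot_proj G 'X_[c (enum_val i)]), Z'; split=> //.
  apply: box_partition_stanley => [i|a /coverL[i ai]|i j a ai aj]; first exact: boxL.
    by exists (enum_rank i); rewrite /Z' enum_rankK.
  exact/enum_val_inj/(disj _ _ a).
have [||_] := @nat_maxP P n; [by exists (stanley_decomposition_depth Z') | |exact].
move=> _ [r [m [Z0 [_ <-]]]]; rewrite /stanley_decomposition_depth.
by elim/big_rec: _ => // i s _ sn; rewrite geq_min sn orbT.
Qed.

End StanleyDecomposition.

(** * Partitions of sets of monomials into boxes *)
Section BoxPartitions.
Variable n : nat.
Implicit Types (A : 'X_{1..n} -> Prop) (a b c : 'X_{1..n}) (F : {set 'I_n}) (p : 'I_n).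

Lemma box_partition_ext A A' t :
  (forall a, A a <-> A' a) -> box_partition A t -> box_partition A' t.
Proof. by move=> AA'; have -> : A = A' by apply/funext => a; apply/propext. Qed.

Lemma box_partitionU A1 A2 t : (forall a, A1 a -> ~ A2 a) ->
  box_partition A1 t -> box_partition A2 t ->
  box_partition (fun a => A1 a \/ A2 a) t.
Proof.
move=> A12 [I1 [c1 [Z1 [t1 in1 cov1 dis1]]]] [I2 [c2 [Z2 [t2 in2 cov2 dis2]]]].
exists (I1 + I2)%type.
exists (fun i => match i with inl j => c1 j | inr j => c2 j end).
exists (fun i => match i with inl j => Z1 j | inr j => Z2 j end); split.
- by case.
- by case=> i a => [/in1|/in2]; [left|right].
- by move=> a [/cov1|/cov2] [i ai]; [exists (inl i)|exists (inr i)].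
- case=> i [] j a ai aj.
  + by congr inl; apply: dis1 ai aj.
  + by case: (A12 a); [apply: in1 ai|apply: in2 aj].
  + by case: (A12 a); [apply: in1 aj|apply: in2 ai].
  + by congr inr; apply: dis2 ai aj.
Qed.

(** A partition into boxes amounts to a map that sends each element to the corner
    of its box and is constant on boxes; the bound B makes the corners finite in
    number. *)
Lemma box_partition_corner A (corner : 'X_{1..n} -> 'X_{1..n})
    (Z : 'X_{1..n} -> {set 'I_n}) (B t : nat) :
  (forall a i, A a -> corner a i <= B) ->
  (forall a, A a -> t <= #|Z (corner a)|) ->
  (forall a, A a -> in_box (corner a) (Z (corner a)) a) ->
  (forall a b, A a -> in_box (corner a) (Z (corner a)) b ->
     A b /\ corner b = corner a) ->
  box_partition A t.
Proof.
move=> cB tZ abox boxA.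
pose toM (c : {ffun 'I_n -> 'I_B.+1}) := [multinom nat_of_ord (c i) | i < n].
pose isC (c : {ffun 'I_n -> 'I_B.+1}) := `[< exists2 a, A a & corner a = toM c >].
exists {c | isC c}, (toM \o val), (Z \o toM \o val); split=> /=.
- by case=> c /= /asboolP[a Aa <-]; apply: tZ.
- by case=> c /= /asboolP[a Aa <-] b /(boxA _ _ Aa)[].
- move=> a Aa.
  have Dc : corner a = toM [ffun i => inord (corner a i)].
    by apply/mnmP => i; rewrite mnmE ffunE inordK // ltnS cB.
  have Cc : isC [ffun i => inord (corner a i)] by apply/asboolP; exists a.
  by exists (Sub _ Cc); rewrite /= -Dc; apply: abox.
- move=> [c /= Cc] [c' /= Cc'] b.
  have /asboolP[a Aa Da] := Cc; have /asboolP[a' Aa' Da'] := Cc'.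
  rewrite -Da -Da' => /(boxA _ _ Aa)[_ E] /(boxA _ _ Aa')[_ E'].
  apply/val_inj/ffunP => i; apply/val_inj; rewrite /=.
  have /mnmP/(_ i) : toM c = toM c' by rewrite -Da -Da' -E -E'.
  by rewrite !mnmE.
Qed.

(** The set A ignores the coordinates in F, and sees the other ones only up to B;
    this is what an ideal generated in bounded degree satisfies. *)
Definition stable F B A : Prop :=
  forall a b, (forall i, i \notin F -> minn (a i) B = minn (b i) B) -> A a -> A b.

Lemma stable_box_partition F B A : stable F B A -> box_partition A #|F|.
Proof.
move=> stA.
pose corner a := [multinom if i \in F then 0 else minn (a i) B | i < n].
pose Z c := F :|: [set i | c i == B :> nat].
apply: (@box_partition_corner _ corner Z B) => [a i _|a _|a _|a b Aa].
- by rewrite mnmE; case: ifP => // _; rewrite geq_minr.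
- exact/subset_leq_card/subsetUl.
- apply/forallP => i; rewrite !inE mnmE.
  by case: (i \in F) => //=; case: ifP; lia.
- move=> /forallP bbox; have E i : i \notin F -> minn (a i) B = minn (b i) B.
    move=> iF; have := bbox i; rewrite !inE mnmE (negPf iF) /=.
    by case: ifP; lia.
  split; first exact: stA Aa.
  by apply/mnmP => i; rewrite !mnmE; case: ifPn => // /E.
Qed.

Definition update p k a := [multinom if i == p then k else a i | i < n].

(** On each line parallel to the axis p the set A is empty or a half-line.  The
    lowest point of that half-line, which is at most B, is the p-coordinate of the
    corner, so that all boxes have p as a free direction. *)
Lemma stable_up_box_partition F B p A : p \notin F -> stable F B A ->
  (forall a, A a -> A (a + U_(p))%MM) -> box_partition A #|F|.+1.
Proof.
move=> pF stA upA.
have upA' a b : (forall i, i != p -> a i = b i) -> a p <= b p -> A a -> A b.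
  move=> ab abp Aa; have -> : b = (a + U_(p) *+ (b p - a p))%MM.
    apply/mnmP => i; rewrite mnmDE mulmnE mnm1E eq_sym.
    by case: eqVneq => [->|/ab<-]; lia.
  by elim: (b p - a p) => [|k IH]; rewrite ?mulm0n ?addm0 // mulmSr addmA; apply: upA.
have exk a : exists k, `[< A (update p k a) \/ ~ A a >].
  exists (a p); apply/asboolP; case: (pselect (A a)) => [Aa|]; [left|by right].
  by apply: upA' Aa => [i ip|]; rewrite mnmE ?eqxx // (negPf ip).
pose height a := ex_minn (exk a).
have heightA a : A a -> A (update p (height a) a).
  by move=> Aa; rewrite /height; case: ex_minnP => k /asboolP[].
have height_min a k : A (update p k a) -> height a <= k.
  by move=> Ak; rewrite /height; case: ex_minnP => h _; apply; apply/asboolP; left.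
pose corner a :=
  [multinom if i \in F then 0 else if i == p then height a else minn (a i) B | i < n].
pose Z c := p |: F :|: [set i | c i == B :> nat].
apply: (@box_partition_corner _ corner Z B) => [a i Aa|a _|a Aa|a b Aa].
- rewrite mnmE; case: ifP => // _; case: ifP => _; last by rewrite geq_minr.
  have := geq_minr (a p) B; apply: leq_trans; apply: height_min; apply: stA Aa => j jF.
  by rewrite mnmE; case: eqP => [->|//]; rewrite -minnA minnn.
- have -> : #|F|.+1 = #|p |: F| by rewrite cardsU1 pF.
  exact/subset_leq_card/subsetUl.
- apply/forallP => i; rewrite !inE mnmE; case: eqVneq => [->|ip] /=.
    rewrite (negPf pF); apply: height_min; apply: upA' Aa => [j jp|].
      by rewrite mnmE (negPf jp).
    by rewrite mnmE eqxx.
  by case: (i \in F) => //=; case: ifP; lia.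
- move=> /forallP bbox.
  have E i : i \notin F -> i != p -> minn (a i) B = minn (b i) B.
    move=> iF ip; have := bbox i; rewrite !inE mnmE (negPf iF) (negPf ip) /=.
    by case: ifP; lia.
  have bp : height a <= b p.
    by have := bbox p; rewrite !inE eqxx /= mnmE (negPf pF) eqxx.
  have upd k : A (update p k a) <-> A (update p k b).
    by split; apply: stA => i iF; rewrite !mnmE; case: eqVneq => // /(E _ iF).
  have Ab : A b.
    apply: upA' ((upd _).1 (heightA _ Aa)) => [i ip|]; first by rewrite mnmE (negPf ip).
    by rewrite mnmE eqxx.
  split=> //; apply/mnmP => i; rewrite !mnmE; case: ifPn => // iF.
  case: eqVneq => [_|/(E _ iF)//].
  by apply/eqP; rewrite eqn_leq !height_min //; [apply/upd|apply/upd]; apply: heightA.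
Qed.

End BoxPartitions.

(** * The lexicographic order *)
Section Lex.
Variable n : nat.
Implicit Types (a b c : 'X_{1..n}) (i j : 'I_n).

Definition lex_gt a b : Prop :=
  exists i : 'I_n, (forall j : 'I_n, j < i -> a j = b j) /\ b i < a i.

Lemma lex_ge_total a b : lex_ge a b \/ lex_gt b a.
Proof.
have [->|ab] := eqVneq a b; first by left; left.
have [i0 abi0] : exists i, a i != b i.
  apply/existsP; apply: contra_neqT ab; rewrite negb_exists => /forallP ab.
  by apply/mnmP => i; apply/eqP; have := ab i; rewrite negbK.
case: (@arg_minnP _ i0 (fun i => a i != b i) val abi0) => i abi imin.
have eqi j : j < i -> a j = b j.
  by move=> ji; apply/eqP; apply: contraTT ji => /imin; rewrite -leqNgt.
move: abi; rewrite neq_ltn => /orP[abi|bai]; last by left; right; exists i.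
by right; exists i; split=> // j /eqi.
Qed.

Lemma lex_ge_trans b a c : lex_ge a b -> lex_ge b c -> lex_ge a c.
Proof.
move=> [->//|[i [abi bi]]] [<-|[j [bcj cj]]]; right; first by exists i.
case: (ltngtP i j) => [ij|ji|/val_inj ij].
- exists i; split=> [k ki|]; last by rewrite -bcj.
  by rewrite abi // bcj // (ltn_trans ki).
- exists j; split=> [k kj|]; last by rewrite abi.
  by rewrite abi ?bcj // (ltn_trans kj).
- exists i; split=> [k ki|]; last by rewrite -ij in cj; rewrite (ltn_trans cj).
  by rewrite abi // bcj // -ij.
Qed.

Lemma lex_geD2r c a b : lex_ge (a + c)%MM (b + c)%MM <-> lex_ge a b.
Proof.
split=> [[/addIm->|[i [abi bi]]]|[->|[i [abi bi]]]]; [by left | | by left | ].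
  right; exists i; split=> [j /abi|]; last by move: bi; rewrite !mnmDE ltn_add2r.
  by rewrite !mnmDE => /addIn.
right; exists i; split=> [j /abi|]; last by rewrite !mnmDE ltn_add2r.
by rewrite !mnmDE => ->.
Qed.

Lemma lex_geD2l c a b : lex_ge (c + a)%MM (c + b)%MM <-> lex_ge a b.
Proof. by rewrite ![(c + _)%MM]addmC; apply: lex_geD2r. Qed.

Lemma lex_geU i j : lex_ge U_(i) U_(j) <-> i <= j.
Proof.
split=> [[/eqP|[k [ijk]]]|].
- by rewrite eq_mnm1 => /eqP->.
- rewrite !mnm1E; case: (i =P k) ijk => [<-|_] ijk; last by rewrite ltn0.
  move=> _; rewrite leqNgt; apply/negP => jk; have := ijk _ jk.
  by rewrite !mnm1E eqxx -val_eqE /= gtn_eqF.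
- rewrite leq_eqVlt => /orP[/eqP/val_inj->|ij]; first by left.
  right; exists i; split=> [k ki|]; last by rewrite !mnm1E eqxx -val_eqE /= gtn_eqF.
  by rewrite !mnm1E -!val_eqE /= !gtn_eqF // (ltn_trans ki).
Qed.

Lemma lex_ge_coord a b i :
  lex_ge a b -> (forall j : 'I_n, j < i -> a j = b j) -> b i <= a i.
Proof.
move=> [->//|[k [abk bk]]] abi; case: (ltngtP i k) => [/abk->//|/abi E|/val_inj->].
  by rewrite E ltnn in bk.
exact: ltnW.
Qed.

Lemma lex_ge_zero a b i : lex_ge a b ->
  (forall j : 'I_n, j < i -> a j = 0) -> forall j : 'I_n, j < i -> b j = 0.
Proof.
move=> ab a0 j; have [m] := ubnP j; elim: m j => // m IH j jm ji.
apply/eqP; rewrite -leqn0 -(a0 _ ji); apply: lex_ge_coord => // k kj.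
have ki : k < i by exact: ltn_trans kj ji.
by rewrite a0 // IH // (leq_trans kj).
Qed.

Lemma mnm1_lt i (k : 'I_n) : k < i -> U_(i)%MM k = 0.
Proof. by move=> ki; rewrite mnm1E -val_eqE /= gtn_eqF. Qed.

Lemma mdeg_ge a i : a i <= mdeg a.
Proof. by rewrite mdegE (bigD1 i) //= leq_addr. Qed.

Lemma mdeg_ge2 a i j : i != j -> a i + a j <= mdeg a.
Proof.
by move=> ij; rewrite mdegE (bigD1 i) //= (bigD1 j) 1?eq_sym //= leq_add2l leq_addr.
Qed.

Lemma mdeg_le a b : (a <= b)%MM -> mdeg a <= mdeg b.
Proof. by move=> /mnm_lepP ab; rewrite !mdegE leq_sum. Qed.

Lemma lepm_mdeg_eq a b : (a <= b)%MM -> mdeg b <= mdeg a -> a = b.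
Proof.
move=> ab; rewrite -(submK ab) mdegD -[X in _ <= X]add0n leq_add2r leqn0 mdeg_eq0.
by move=> /eqP->; rewrite add0m.
Qed.

Lemma mdeg_gt0 a : 0 < mdeg a -> exists i, 0 < a i.
Proof.
move=> a0; apply/existsP; apply: contraLR a0; rewrite negb_exists => /forallP a0.
rewrite -eqn0Ngt mdeg_eq0; apply/eqP/mnmP => i; rewrite mnm0E.
by apply/eqP; have := a0 i; rewrite -eqn0Ngt.
Qed.

Lemma submUK a i : 0 < a i -> (a - U_(i) + U_(i))%MM = a.
Proof. by move=> ai; rewrite submK // lep1mP -lt0n. Qed.

Definition lexset d u v : 'X_{1..n} -> Prop :=
  fun g => [/\ mdeg g = d, lex_ge u g & lex_ge g v].

End Lex.

Lemma lex_ge_anti n (a b : 'X_{1..n}) : lex_ge a b -> lex_ge b a -> a = b.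
Proof.
move=> ab ba; apply/mnmP => i; have [m] := ubnP i; elim: m i => // m IH i im.
have E (j : 'I_n) : j < i -> a j = b j by move=> ji; apply: IH; apply: leq_trans ji im.
apply/eqP; rewrite eqn_leq (lex_ge_coord ab E) andbT.
by apply: lex_ge_coord ba _ => j /E.
Qed.

Lemma lex_ge_last n (a : 'X_{1..n.+1}) : lex_ge a (U_(ord_max) *+ mdeg a)%MM.
Proof.
have [//|[i [ai]]] := lex_ge_total a (U_(ord_max) *+ mdeg a)%MM.
rewrite mulmnE mnm1E; case: eqVneq => [mi|]; last by rewrite mul0n ltn0.
rewrite mul1n ltnNge => /negP[]; suff -> : a = (U_(ord_max) *+ a i)%MM by rewrite mdegMn mdeg1 mulmnE -mi mnm1E eqxx.
apply/mnmP => k; rewrite mulmnE mnm1E; case: eqVneq => [<-|mk]; first by rewrite mul1n -mi.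
rewrite -ai ?mulmnE ?mnm1E ?(negPf mk) ?mul0n // -mi ltn_neqAle eq_sym val_eqE mk.
exact: leq_ord.
Qed.

Lemma lexset_common_prefix n d (u v g : 'X_{1..n}) (q : 'I_n) : lexset d u v g ->
  (forall k : 'I_n, k < q -> u k = v k) -> forall k : 'I_n, k < q -> g k = v k.
Proof.
move=> [_ ug gv] uvq k; have [m] := ubnP k; elim: m k => // m IH k km kq.
have E (j : 'I_n) : j < k -> g j = v j.
  by move=> jk; apply: IH; [exact: leq_trans jk km | exact: ltn_trans jk kq].
apply/eqP; rewrite eqn_leq (lex_ge_coord gv E) andbT -uvq //.
by apply: lex_ge_coord ug _ => j jk; rewrite E // uvq // (ltn_trans jk).
Qed.

(** * Dividing out a common factor *)
Section Peeling.
Variable n : nat.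
Implicit Types (L A : 'X_{1..n} -> Prop) (a b c : 'X_{1..n}) (i : 'I_n).

(** A witness w for depth <= n - |Y| together with boxes for sdepth >= n - |Y|.
    Requiring Y to be nonempty leaves room, under a multiplication of the
    generators by x_i, for the box of the monomials prime to x_i, which has
    dimension n - 1. *)
Definition depth_matched L : Prop :=
  exists (w : 'X_{1..n}) (Y : {set 'I_n}),
  [/\ ~ divisible L w, forall i, i \in Y -> divisible L (w + U_(i))%MM,
      0 < #|Y| & box_partition (fun a => ~ divisible L a) (n - #|Y|)].

Lemma box_partition_le A t t' : t' <= t -> box_partition A t -> box_partition A t'.
Proof.
move=> t't [I [c [Z [tZ inA cov dis]]]]; exists I, c, Z; split=> // i.
exact: leq_trans (tZ i).
Qed.

Lemma box_partition_shift A t i : box_partition A t ->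
  box_partition (fun a => 0 < a i /\ A (a - U_(i))%MM) t.
Proof.
move=> [I [c [Z [tZ inA cov dis]]]].
have shiftE k a : in_box (c k + U_(i))%MM (Z k) a <->
    0 < a i /\ in_box (c k) (Z k) (a - U_(i))%MM.
  split=> [/forallP ca|[ai /forallP ca]].
    split; first by have := ca i; rewrite mnmDE mnm1E eqxx; case: ifP; lia.
    apply/forallP => j; have := ca j; rewrite mnmDE mnmBE mnm1E.
    by case: ifP; case: (i == j); lia.
  apply/forallP => j; have := ca j; rewrite mnmDE mnmBE mnm1E.
  by case: eqVneq => [<-|_]; case: ifP; lia.
exists I, (fun k => c k + U_(i))%MM, Z; split=> //.
- by move=> k a /shiftE[ai /inA].
- by move=> a [ai /cov[k ak]]; exists k; apply/shiftE.
- by move=> k l a /shiftE[_ ak] /shiftE[_ al]; apply: dis ak al.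
Qed.

Lemma box_partition_zero i : box_partition (fun a => a i = 0) n.-1.
Proof.
have -> : n.-1 = #|~: [set i]| by rewrite cardsCs setCK cards1 card_ord subn1.
apply: (@stable_box_partition _ _ 1) => a b /(_ i); rewrite !inE eqxx => /(_ isT).
by lia.
Qed.

Lemma depth_matched_var i : depth_matched (fun g => g = U_(i)%MM).
Proof.
have divE a : divisible (fun g => g = U_(i)%MM) a <-> 0 < a i.
  split=> [[g ->]|ai]; first by rewrite lep1mP lt0n.
  by exists U_(i)%MM; rewrite ?lep1mP -?lt0n.
exists 0%MM, [set i]; rewrite cards1 subn1; split=> //.
- by rewrite divE mnm0E.
- by move=> j; rewrite inE => /eqP->; rewrite divE mnmDE mnm1E eqxx addn1.
- apply: box_partition_ext (box_partition_zero i) => a.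
  by rewrite divE; lia.
Qed.

(** The monomials outside x_i J are those prime to x_i and the translates by x_i
    of those outside J; both the witness and the boxes of J are translated. *)
Lemma depth_matched_shift L i : depth_matched L ->
  depth_matched (fun g => exists2 h, L h & g = (h + U_(i))%MM).
Proof.
move=> [w [Y [wL wY Y0 bp]]]; set L' := fun g => _.
have divE a : divisible L' a <-> 0 < a i /\ divisible L (a - U_(i))%MM.
  split=> [[_ [h Lh ->] /mnm_lepP ha]|[ai [h Lh ha]]].
    have ai : 0 < a i by have := ha i; rewrite mnmDE mnm1E eqxx; lia.
    split=> //; exists h => //; apply/mnm_lepP => j; have := ha j.
    by rewrite mnmDE mnmBE; lia.
  exists (h + U_(i))%MM; first by exists h.
  rewrite -[a](submUK ai); apply/mnm_lepP => j; rewrite !mnmDE leq_add2r.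
  exact: (mnm_lepP ha).
exists (w + U_(i))%MM, Y; split=> //.
- by rewrite divE addmK => -[].
- move=> j /wY wj; rewrite divE -addmA [(U_(i) + _)%MM]addmC addmA addmK.
  by split=> //; rewrite !mnmDE !mnm1E eqxx; lia.
- have le : n - #|Y| <= n.-1 by rewrite -subn1 leq_sub2l.
  have dis a : a i = 0 -> ~ (0 < a i /\ ~ divisible L (a - U_(i))%MM).
    by move=> -> [].
  have := box_partitionU dis (box_partition_le le (box_partition_zero i))
    (box_partition_shift i bp).
  apply: box_partition_ext => a; rewrite divE; split=> [[->|[_ aL] []]//|aL].
    by case.
  case: (posnP (a i)) => ai; [by left|right].
  by split=> // aL'; apply: aL.
Qed.

Lemma lexset_shift d (u v : 'X_{1..n}) i :
  (forall g, lexset d.+1 (u + U_(i))%MM (v + U_(i))%MM g -> 0 < g i) ->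
  lexset d.+1 (u + U_(i))%MM (v + U_(i))%MM =
  (fun g => exists2 h, lexset d u v h & g = (h + U_(i))%MM).
Proof.
move=> gi; apply/funext => g; apply/propext; split=> [Lg|[h [dh uh hv] ->]].
  have := Lg; rewrite -{1}(submUK (gi _ Lg)) => -[dg ug gv].
  exists (g - U_(i))%MM; last by rewrite submUK ?gi.
  split; [|exact/lex_geD2r/ug|exact/lex_geD2r/gv].
  by apply/eqP; rewrite -eqSS -dg mdegD mdeg1 addn1.
by split; [rewrite mdegD mdeg1 dh addn1|apply/lex_geD2r|apply/lex_geD2r].
Qed.

End Peeling.

(** * Lexsegments without a common factor *)
Section NormalizedSegment.
Variables (n d : nat) (u v : 'X_{1..n.+1}) (q : 'I_n.+1).
Hypotheses (du : mdeg u = d.+1) (dv : mdeg v = d.+1).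
Hypothesis u0 : forall k : 'I_n.+1, k < q -> u k = 0.
Hypothesis v0 : forall k : 'I_n.+1, k <= q -> v k = 0.
Hypothesis uq : 0 < u q.
Implicit Types (a b g h w : 'X_{1..n.+1}) (F Y : {set 'I_n.+1}) (i j k p : 'I_n.+1).

Local Notation L := (lexset d.+1 u v).
Local Notation xn := (U_(@ord_max n))%MM.

Lemma segment_prefix g : L g -> forall k, k < q -> g k = 0.
Proof. by case=> _ ug _; apply: lex_ge_zero ug u0. Qed.

Lemma segment_head_le g : L g -> g q <= u q.
Proof.
move=> Lg; have [_ ug _] := Lg; apply: lex_ge_coord ug _ => k kq.
by rewrite u0 // (segment_prefix Lg).
Qed.

Lemma segment_lower g :
  mdeg g = d.+1 -> (forall k, k <= q -> g k = 0) -> lex_ge g v -> L g.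
Proof.
move=> dg g0 gv; split=> //; right; exists q; rewrite g0 //.
by split=> // k kq; rewrite u0 // g0 // ltnW.
Qed.

Lemma segment_upper g : mdeg g = d.+1 -> (forall k, k < q -> g k = 0) ->
  0 < g q -> lex_ge u g -> L g.
Proof.
move=> dg g0 gq ug; split=> //; right; exists q; rewrite v0 //.
by split=> // k kq; rewrite v0 ?g0 // ltnW.
Qed.

Lemma q_lt_max : q < @ord_max n.
Proof.
have [i vi] : exists i, 0 < v i by apply: mdeg_gt0; rewrite dv.
apply: leq_trans (leq_ord i); rewrite ltnNge; apply/negP => /v0 E.
by rewrite E in vi.
Qed.

Lemma xn_q : xn q = 0.
Proof. by rewrite mnm1E -val_eqE gtn_eqF ?q_lt_max. Qed.

Lemma stable_segment F : (forall g k, L g -> k \in F -> g k = 0) ->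
  stable F d.+1 (fun a => ~ divisible L a).
Proof.
move=> LF a b ab aL [g Lg /mnm_lepP gb]; apply: aL; exists g => //.
apply/mnm_lepP => i; have [iF|iF] := boolP (i \in F); first by rewrite (LF _ _ Lg).
have := ab i iF; have := gb i; case: Lg => dg _ _; have := mdeg_ge g i.
by rewrite dg; lia.
Qed.

Lemma not_divisible_mdeg a : mdeg a <= d -> ~ divisible L a.
Proof. by move=> ad [g [dg _ _] /mdeg_le]; rewrite dg => /leq_trans/(_ ad); rewrite ltnn. Qed.

Lemma card_tail_setC : #|~: [set i : 'I_n.+1 | q <= i]| = n.+1 - #|[set i : 'I_n.+1 | q <= i]|.
Proof. by rewrite cardsCs setCK card_ord. Qed.

(** The witness u/x_q is sent into the segment by x_q, ..., x_n, and the generators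
    involve only these variables. *)
Lemma depth_matched_depth_zero : lex_ge (u - U_(q) + xn)%MM v -> depth_matched L.
Proof.
move=> uv; exists (u - U_(q))%MM, [set i : 'I_n.+1 | q <= i]; rewrite -card_tail_setC.
have dw : mdeg (u - U_(q))%MM = d.
  by have := du; rewrite -{1}(submUK uq) mdegD mdeg1 addn1 => -[].
split.
- by apply: not_divisible_mdeg; rewrite dw.
- move=> i; rewrite inE => qi; exists (u - U_(q) + U_(i))%MM; last exact: lepm_refl.
  split; first by rewrite mdegD mdeg1 dw addn1.
    by rewrite -{1}(submUK uq); apply/lex_geD2l/lex_geU.
  by apply: lex_ge_trans uv; apply/lex_geD2l/lex_geU/leq_ord.
- by apply/card_gt0P; exists q; rewrite inE.
- apply/stable_box_partition/stable_segment => g k Lg.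
  by rewrite !inE -ltnNge; apply: segment_prefix.
Qed.

Hypothesis uv : ~ lex_ge (u - U_(q) + xn)%MM v.

Lemma u_head : u q = 1.
Proof.
apply/eqP; rewrite eqn_leq uq andbT leqNgt; apply/negP => u2; apply: uv.
right; exists q; rewrite v0 // mnmDE mnmBE mnm1E eqxx; split; last by lia.
move=> k kq; rewrite v0 1?ltnW // mnmDE mnmBE u0 // sub0n mnm1E.
by rewrite -val_eqE gtn_eqF //; apply: ltn_trans kq q_lt_max.
Qed.

Lemma segment_head g : L g -> g q <= 1.
Proof. by move/segment_head_le; rewrite u_head. Qed.

(** Suppose that g is a generator dividing x^a x_n and that h is one dividing
    x^a x_q.  Then g = g' x_n and h = h' x_q, where g' and h' divide x^a and
    involve only variables after x_q.  If some such variable x_i occurs more often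
    in x^a than in g', then g' x_i is a generator that divides x^a, since
    g' x_i >= g' x_n >= v.  Otherwise h' divides g', so h' = g' by degree, and
    x_n u/x_q >= x_n h' = g >= v, against the hypothesis on u and v. *)
Lemma segment_notin_mul_last a : ~ divisible L a -> divisible L (a + U_(q))%MM ->
  ~ divisible L (a + xn)%MM.
Proof.
move=> aL [h Lh /mnm_lepP ha] [g Lg /mnm_lepP ga].
have [dh uh _] := Lh; have [dg ug gv] := Lg.
have [aq hq] : a q = 0 /\ h q = 1.
  have := segment_head Lh; have [hq|] := leqP (h q) (a q).
    case: aL; exists h => //; apply/mnm_lepP => i.
    have [->//|iq] := eqVneq i q.
    by have := ha i; rewrite mnmDE mnm1E eq_sym (negPf iq) addn0.
  lia.
have gn : 0 < g ord_max.
  rewrite lt0n; apply/negP => /eqP gn; apply: aL; exists g => //.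
  apply/mnm_lepP => i; have := ga i; rewrite mnmDE mnm1E.
  by have [<-|_] := eqVneq ord_max i; rewrite ?gn // addn0.
have gq : g q = 0.
  by have := ga q; rewrite mnmDE xn_q aq addn0 leqn0 => /eqP.
have dg' : mdeg (g - xn)%MM = d.
  by have := dg; rewrite -{1}(submUK gn) mdegD mdeg1 addn1 => -[].
have dh' : mdeg (h - U_(q))%MM = d.
  by have := dh; rewrite -{1}(submUK (a := h) (i := q)) ?hq // mdegD mdeg1 addn1 => -[].
have g'0 k : k <= q -> (g - xn)%MM k = 0.
  rewrite leq_eqVlt => /orP[/eqP/val_inj->|kq]; first by rewrite mnmBE gq.
  by rewrite mnmBE (segment_prefix Lg).
have g'a i : (g - xn)%MM i <= a i.
  by have := ga i; rewrite mnmBE mnmDE; lia.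
have [/existsP[i /andP[qi gai]]|] := boolP [exists i : 'I_n.+1, (q < i) && ((g - xn)%MM i < a i)].
  apply: aL; exists (g - xn + U_(i))%MM; last first.
    apply/mnm_lepP => j; rewrite mnmDE mnm1E; have := g'a j.
    by have [<-|] := eqVneq i j; rewrite ?addn0 // addn1.
  apply: segment_lower; first by rewrite mdegD mdeg1 dg' addn1.
    by move=> k kq; rewrite mnmDE g'0 // mnm1E -val_eqE /= gtn_eqF // (leq_ltn_trans kq).
  apply: lex_ge_trans gv; rewrite -{2}(submUK gn).
  exact/lex_geD2l/lex_geU/leq_ord.
rewrite negb_exists => /forallP ag.
have hg : (h - U_(q))%MM = (g - xn)%MM.
  apply: lepm_mdeg_eq; last by rewrite dg' dh'.
  apply/mnm_lepP => i; have [iq|qi] := leqP i q.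
    rewrite mnmBE mnm1E; have [<-|qi] := eqVneq q i; first by rewrite hq subnn.
    by rewrite (segment_prefix Lh) // ltn_neqAle iq andbT eq_sym.
  have := ag i; rewrite qi -leqNgt => /(leq_trans _); apply.
  by have := ha i; rewrite mnmBE mnmDE; lia.
apply: uv; apply: lex_ge_trans gv; rewrite -(submUK gn) -hg.
apply/lex_geD2r; apply/(lex_geD2r U_(q)%MM).
by rewrite !submUK ?hq.
Qed.

(** Monomials that stay outside the ideal after multiplication by x_q form a set
    independent of the exponent of x_q, as x_q divides each generator at most once.
    The other monomials outside the ideal form a set closed under multiplication by
    x_n.  Each part has one free direction besides F. *)
Lemma segment_box_partition F : (forall g k, L g -> k \in F -> g k = 0) ->
  q \notin F -> ord_max \notin F ->
  box_partition (fun a => ~ divisible L a) #|F|.+1.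
Proof.
move=> LF qF nF.
have divU a p : divisible L a -> divisible L (a + U_(p))%MM.
  by move/divisible_trans; apply; apply: lem_addr.
have bp1 : box_partition (fun a => ~ divisible L (a + U_(q))%MM) #|F|.+1.
  have -> : #|F|.+1 = #|q |: F| by rewrite cardsU1 qF.
  apply: (@stable_box_partition _ _ d.+1) => a b ab aL [g Lg /mnm_lepP gb].
  apply: aL; exists g => //; apply/mnm_lepP => i.
  have [iF|iF] := boolP (i \in F); first by rewrite (LF _ _ Lg).
  have [->|iq] := eqVneq i q.
    by rewrite mnmDE mnm1E eqxx (leq_trans (segment_head Lg)) // leq_addl.
  have := ab i; rewrite !inE (negPf iF) (negPf iq) => /(_ isT).
  have := gb i; rewrite !mnmDE; case: Lg => dg _ _; have := mdeg_ge g i.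
  by rewrite dg; lia.
have bp2 : box_partition
    (fun a => ~ divisible L a /\ divisible L (a + U_(q))%MM) #|F|.+1.
  apply: (@stable_up_box_partition _ _ d.+1 ord_max) => //.
    move=> a b ab [aL aqL]; split; first exact: stable_segment LF _ _ ab aL.
    apply: contrapT => bqL.
    have ab' i : i \notin F ->
        minn ((b + U_(q))%MM i) d.+1 = minn ((a + U_(q))%MM i) d.+1.
      by move=> /ab; rewrite !mnmDE; lia.
    exact: stable_segment LF _ _ ab' bqL aqL.
  move=> a [aL aqL]; split; first exact: (segment_notin_mul_last aL aqL).
  by rewrite -addmA [(xn + _)%MM]addmC addmA; apply: divU.
have dis a : ~ divisible L (a + U_(q))%MM ->
  ~ (~ divisible L a /\ divisible L (a + U_(q))%MM) by move=> aqL [].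
apply: box_partition_ext (box_partitionU dis bp1 bp2) => a; split=> [[aL|[]//]|aL].
  by move=> aL'; apply/aL/divU.
by case: (pselect (divisible L (a + U_(q))%MM)); [right|left].
Qed.

(** The set F of free variables is the complement of Y without p, where p is the
    one of x_q, x_n that is not in Y and supplies the additional free
    direction. *)
Lemma depth_matched_witness w Y p :
  ~ divisible L w -> (forall i, i \in Y -> divisible L (w + U_(i))%MM) ->
  0 < #|Y| -> p \notin Y ->
  (forall g k, L g -> k \notin Y -> k != p -> g k = 0) ->
  (q == p) || (q \in Y) -> (ord_max == p) || (ord_max \in Y) ->
  depth_matched L.
Proof.
move=> wL wY Y0 pY LY qY nY; exists w, Y; split=> //.
have cY : #|~: Y| = n.+1 - #|Y| by rewrite cardsCs setCK card_ord.
rewrite -cY (cardsD1 p) inE pY add1n.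
apply: segment_box_partition.
- by move=> g k Lg; rewrite !inE => /andP[kp kY]; apply: LY.
- by rewrite !inE negb_and !negbK.
- by rewrite !inE negb_and !negbK.
Qed.

(** Here u = x_q and v = x_j with j < n, and the ideal is generated by
    x_q, ..., x_j; the witness is 1. *)
Lemma depth_matched_degree_one : d = 0 -> depth_matched L.
Proof.
move=> d0; have du1 := du; have dv1 := dv; rewrite d0 in du1 dv1.
have uE : u = U_(q)%MM.
  by symmetry; apply: lepm_mdeg_eq; rewrite ?lep1mP ?mdeg1 ?du1 -?lt0n.
have /mdeg1P[j /eqP vE] : mdeg v == 1 by rewrite dv1.
have qj : q < j by rewrite ltnNge; apply/negP => /v0; rewrite vE mnm1E eqxx.
have jn : j < @ord_max n.
  rewrite ltnNge; apply/negP => nj; apply: uv.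
  have -> : (u - U_(q) + xn)%MM = xn.
    by apply/mnmP => k; rewrite mnmDE mnmBE uE subnn.
  by rewrite vE; apply/lex_geU.
have LU g : L g -> exists2 i, g = U_(i)%MM & q <= i <= j.
  move=> Lg; have [dg _ gv] := Lg; move/eqP: dg; rewrite d0 => /mdeg1P[i /eqP gE].
  exists i => //; rewrite leqNgt; apply/andP; split; last by apply/lex_geU; rewrite -gE -vE.
  by apply/negP => /(segment_prefix Lg); rewrite gE mnm1E eqxx.
apply: (@depth_matched_witness 0%MM [set i : 'I_n.+1 | q <= i <= j] ord_max).
- by apply: not_divisible_mdeg; rewrite mdeg0.
- move=> i; rewrite inE add0m => /andP[qi ij]; exists U_(i)%MM; last exact: lepm_refl.
  by split; [rewrite mdeg1 d0 | rewrite uE; apply/lex_geU | rewrite vE; apply/lex_geU].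
- by apply/card_gt0P; exists q; rewrite inE leqnn ltnW.
- by rewrite inE negb_and -!ltnNge jn orbT.
- move=> g k /LU[i -> qij]; rewrite inE => kY _; rewrite mnm1E.
  by case: eqP => // ik; rewrite ik (negPf kY) in qij.
- by rewrite inE leqnn ltnW // orbT.
- by rewrite eqxx.
Qed.

Hypothesis d0 : 0 < d.
Variable r : 'I_n.+1.
Hypothesis rq : r = q.+1 :> nat.

Lemma tail_prefix (Y : {set 'I_n.+1}) g k : (forall i, q < i -> i \in Y) ->
  L g -> k \notin Y -> k != q -> g k = 0.
Proof.
move=> Yq Lg kY kq; apply: (segment_prefix Lg); rewrite ltn_neqAle kq leqNgt.
by apply: contra kY; apply: Yq.
Qed.

Lemma q_lt_r : q < r. Proof. by rewrite rq. Qed.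

Lemma U_q_r : U_(q)%MM r = 0.
Proof. by rewrite mnm1E -val_eqE ltn_eqF // q_lt_r. Qed.

Lemma r_le i : q < i -> r <= i. Proof. by rewrite rq. Qed.

(** When all variables after x_q kill the witness, the variables before x_q are
    the free ones. *)
Lemma depth_matched_tail w : ~ divisible L w ->
  (forall i, q < i -> divisible L (w + U_(i))%MM) -> depth_matched L.
Proof.
move=> wL wU; apply: (@depth_matched_witness w [set i : 'I_n.+1 | q < i] q) => //.
- by move=> i; rewrite inE => /wU.
- by apply/card_gt0P; exists r; rewrite inE q_lt_r.
- by rewrite inE ltnn.
- by move=> g k; apply: tail_prefix => i; rewrite inE.
- by rewrite eqxx.
- by rewrite inE q_lt_max orbT.
Qed.

(** The witness u/x_r is sent by x_i, for i >= r, to a monomial between u and v. *)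
Lemma depth_matched_next_var : 0 < u r -> depth_matched L.
Proof.
move=> ur; apply: (@depth_matched_tail (u - U_(r))%MM).
  apply: not_divisible_mdeg.
  by have := du; rewrite -{1}(submUK ur) mdegD mdeg1 addn1 => -[->].
move=> i qi; exists (u - U_(r) + U_(i))%MM; last exact: lepm_refl.
apply: segment_upper.
- by have := du; rewrite -{1}(submUK ur) !mdegD !mdeg1.
- move=> k kq; rewrite mnmDE mnmBE u0 // sub0n mnm1_lt //.
  exact: ltn_trans kq qi.
- by rewrite mnmDE mnmBE (mnm1_lt q_lt_r) subn0 ltn_addr.
- by rewrite -{1}(submUK ur); apply/lex_geD2l/lex_geU/r_le.
Qed.

Hypothesis ur : u r = 0.

Lemma segment_head_zero g : L g -> g q = 1 -> g r = 0.
Proof.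
move=> Lg gq; have [_ ug _] := Lg; apply/eqP; rewrite -leqn0 -ur.
apply: lex_ge_coord ug _ => k; rewrite rq ltnS leq_eqVlt => /orP[/eqP/val_inj->|kq].
  by rewrite u_head gq.
by rewrite u0 // (segment_prefix Lg).
Qed.

(** The witness is x_q x_r^d.  It has the degree of the generators, but is greater
    than u, since x_r does not divide u. *)
Lemma depth_matched_small_v : lex_ge (U_(r) *+ d + xn)%MM v -> depth_matched L.
Proof.
move=> rv; apply: (@depth_matched_tail (U_(q) + U_(r) *+ d)%MM).
  move=> [g Lg gw]; have [dg _ _] := Lg.
  have gE : g = (U_(q) + U_(r) *+ d)%MM.
    by apply: lepm_mdeg_eq gw _; rewrite dg mdegD mdegMn !mdeg1 mul1n.
  have := segment_head_zero Lg; rewrite gE !mnmDE !mulmnE U_q_r (mnm1_lt q_lt_r).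
  by rewrite !mnm1E !eqxx => /(_ erefl); lia.
move=> i qi; exists (U_(r) *+ d + U_(i))%MM; last first.
  by apply/mnm_lepP => k; rewrite !mnmDE; lia.
apply: segment_lower.
- by rewrite mdegD mdegMn !mdeg1 mul1n addn1.
- move=> k kq; rewrite mnmDE mulmnE !mnm1_lt //; first exact: leq_ltn_trans kq qi.
  exact: leq_ltn_trans kq q_lt_r.
- by apply: lex_ge_trans rv; apply/lex_geD2l/lex_geU/leq_ord.
Qed.

Variables (j l : 'I_n.+1).
Hypotheses (rj : r <= j) (jn : j < @ord_max n) (vE : v = (U_(r) *+ d + U_(j))%MM).
Hypotheses (rl : r < l) (ul : 0 < u l).
Hypothesis l_min : forall k, q < k -> k < l -> u k = 0.

Lemma r_lt_max : r < @ord_max n. Proof. exact: leq_ltn_trans rj jn. Qed.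

(** Generators divisible by x_q are x_q times a monomial that is at most u/x_q,
    hence involve no variable strictly between x_q and the first variable x_l of
    u/x_q. *)
Lemma segment_free_upper g k : L g -> g q = 1 -> q < k -> k < l -> g k = 0.
Proof.
move=> Lg gq qk kl; have [_ ug _] := Lg.
have E i : i < l -> (u - U_(q))%MM i = 0.
  move=> il; rewrite mnmBE; case: (ltngtP i q) => [iq|qi|/val_inj->].
  - by rewrite u0.
  - by rewrite l_min.
  - by rewrite u_head mnm1E eqxx.
have ug' : lex_ge (u - U_(q))%MM (g - U_(q))%MM.
  by apply/(lex_geD2r U_(q)%MM); rewrite !submUK // gq.
have := lex_ge_zero ug' E kl.
by rewrite mnmBE mnm1E -val_eqE /= ltn_eqF // subn0.
Qed.

(** A generator prime to x_q is at least v = x_r^d x_j, so it is x_r^(d+1) or x_r^d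
    times one variable, which comes no later than x_j. *)
Lemma segment_free_lower g k : L g -> g q = 0 -> j < k -> g k = 0.
Proof.
move=> Lg gq jk; have [dg _ gv] := Lg; apply/eqP; rewrite -leqn0 leqNgt; apply/negP => gk.
have g0 i : i <= q -> g i = 0.
  by rewrite leq_eqVlt => /orP[/eqP/val_inj->|/(segment_prefix Lg)].
have rk : r != k by rewrite -val_eqE ltn_eqF // (leq_ltn_trans rj).
have vr : d <= v r by rewrite vE mnmDE mulmnE mnm1E eqxx mul1n leq_addr.
have gr : v r <= g r.
  apply: lex_ge_coord gv _ => i ir; rewrite g0 ?v0 //.
    by rewrite rq ltnS in ir.
  by rewrite rq ltnS in ir.
have gkr := mdeg_ge2 g rk; rewrite dg in gkr.
have [grE gkE] : g r = d /\ g k = 1 by lia.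
have gE : (U_(r) *+ d + U_(k))%MM = g.
  apply: lepm_mdeg_eq; last by rewrite dg mdegD mdegMn !mdeg1 mul1n addn1.
  apply/mnm_lepP => i; rewrite mnmDE mulmnE !mnm1E.
  have [<-|_] := eqVneq r i; first by rewrite grE eq_sym (negPf rk) mul1n addn0.
  by have [<-|//] := eqVneq k i; rewrite gkE.
by move: gv; rewrite -gE vE => /lex_geD2l/lex_geU; rewrite leqNgt jk.
Qed.

(** The witness x_q x_r^d x_n^(d-1) is killed by x_i for r <= i <= j, because
    x_r^d x_i >= v, and for i >= l, because x_q x_i x_n^(d-1) <= u.  By the two
    previous lemmas the variables strictly between x_j and x_l divide no
    generator. *)
Lemma depth_matched_large_v : depth_matched L.
Proof.
pose w := (U_(q) + U_(r) *+ d + xn *+ d.-1)%MM.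
have qj : q < j := leq_trans q_lt_r rj.
have ql : q < l := ltn_trans q_lt_r rl.
have nr : xn r = 0 by rewrite (mnm1_lt r_lt_max).
apply: (@depth_matched_witness w [set i : 'I_n.+1 | (r <= i <= j) || (l <= i)] q).
- move=> [g Lg /mnm_lepP gw]; have [dg _ gv] := Lg.
  have [gq|gq] : g q = 0 \/ g q = 1 by have := segment_head Lg; lia.
    (* A divisor g >= v of w prime to x_q agrees with v before x_j, so its exponent
       of x_j is at least that of v, which is larger than that of w. *)
    have wE i : i != r -> i < @ord_max n -> g i = 0.
      move=> ir im; apply/eqP; have [->|iq] := eqVneq i q; first by rewrite gq.
      have := gw i; rewrite !mnmDE !mulmnE mnm1E eq_sym (negPf iq).
      by rewrite mnm1E eq_sym (negPf ir) (mnm1_lt im) !mul0n leqn0.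
    have gr : g r <= d.
      by have := gw r; rewrite !mnmDE !mulmnE U_q_r nr mnm1E eqxx mul1n mul0n addn0.
    have vg i : i < r -> g i = v i.
      rewrite rq ltnS => iq; rewrite v0 // wE //.
        by rewrite -val_eqE ltn_eqF // (leq_ltn_trans iq q_lt_r).
      exact: leq_ltn_trans iq q_lt_max.
    have vr := lex_ge_coord gv vg.
    have [jr|jr] := eqVneq j r.
      by move: vr; rewrite vE jr mnmDE mulmnE mnm1E eqxx; lia.
    have vEk i : i != r -> v i = (j == i).
      by move=> ir; rewrite vE mnmDE mulmnE !mnm1E eq_sym (negPf ir) mul0n.
    have vgj i : i < j -> g i = v i.
      move=> ij; have [->|ir] := eqVneq i r.
        apply/eqP; rewrite eqn_leq vr andbT (leq_trans gr) //.
        by rewrite vE mnmDE mulmnE mnm1E eqxx mul1n leq_addr.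
      rewrite vEk // wE //; last exact: ltn_trans ij jn.
      by rewrite -val_eqE gtn_eqF.
    by have := lex_ge_coord gv vgj; rewrite vEk // eqxx wE.
  (* A generator divisible by x_q is prime to x_r, and what remains of w has too
     small a degree. *)
  have : (g <= U_(q) + xn *+ d.-1)%MM.
    apply/mnm_lepP => i; have [->|ir] := eqVneq i r.
      by rewrite (segment_head_zero Lg).
    by have := gw i; rewrite !mnmDE mulmnE [U_(r)%MM i]mnm1E eq_sym (negPf ir) addn0.
  by move=> /mdeg_le; rewrite dg mdegD mdegMn !mdeg1; lia.
- move=> i; rewrite inE => /orP[/andP[ri ij]|li].
    exists (U_(r) *+ d + U_(i))%MM; last first.
      by apply/mnm_lepP => k; rewrite !mnmDE; lia.
    apply: segment_lower.
    + by rewrite mdegD mdegMn !mdeg1 mul1n addn1.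
    + move=> k kq; rewrite mnmDE mulmnE !mnm1_lt //; last exact: leq_ltn_trans kq q_lt_r.
      exact: leq_ltn_trans kq (leq_trans q_lt_r ri).
    + by rewrite vE; apply/lex_geD2l/lex_geU.
  exists (U_(q) + (xn *+ d.-1 + U_(i)))%MM; last first.
    by apply/mnm_lepP => k; rewrite !mnmDE; lia.
  apply: segment_upper.
  + by rewrite !mdegD mdegMn !mdeg1; lia.
  + move=> k kq; rewrite !mnmDE mulmnE !mnm1_lt //.
      exact: ltn_trans kq (leq_trans ql li).
    exact: ltn_trans kq q_lt_max.
  + by rewrite mnmDE mnm1E eqxx.
  + rewrite -{1}(submUK uq) [(_ + U_(q))%MM]addmC; apply/lex_geD2l.
    have ul' : 0 < (u - U_(q))%MM l.
      by rewrite mnmBE mnm1E -val_eqE ltn_eqF // subn0.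
    apply: (@lex_ge_trans _ (xn *+ d.-1 + U_(l))%MM); last exact/lex_geD2l/lex_geU.
    rewrite -(submUK ul'); apply/lex_geD2r.
    have -> : d.-1 = mdeg (u - U_(q) - U_(l))%MM.
      have := du; rewrite -{1}(submUK uq) -{1}(submUK ul') !mdegD !mdeg1.
      by lia.
    exact: lex_ge_last.
- by apply/card_gt0P; exists j; rewrite inE rj leqnn.
- by rewrite inE negb_or negb_and -!ltnNge q_lt_r ql.
- move=> g k Lg; rewrite inE negb_or negb_and -!ltnNge => /andP[krj kl] kq.
  have [kq'|qk|/val_inj] := ltngtP k q; last 1 first.
  + by move/eqP; rewrite (negPf kq).
  + exact: segment_prefix kq'.
  have [gq|gq] : g q = 0 \/ g q = 1 by have := segment_head Lg; lia.
    by apply: segment_free_lower => //; move: krj; rewrite ltnNge r_le.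
  exact: segment_free_upper.
- by rewrite eqxx.
- by rewrite inE [(l <= _)%N]leq_ord !orbT.
Qed.

End NormalizedSegment.

(** In the case x_r^d x_n < v, the first index where these two monomials differ is
    the index j with v = x_r^d x_j, for degree reasons. *)
Lemma depth_matched_normalized n d (u v : 'X_{1..n.+1}) (q : 'I_n.+1) :
  mdeg u = d.+1 -> mdeg v = d.+1 ->
  (forall k : 'I_n.+1, k < q -> u k = 0) ->
  (forall k : 'I_n.+1, k <= q -> v k = 0) -> 0 < u q ->
  depth_matched (lexset d.+1 u v).
Proof.
move=> du dv u0 v0 uq.
case: (pselect (lex_ge (u - U_(q) + U_(ord_max))%MM v)) => [|uv].
  exact: (depth_matched_depth_zero du dv u0 uq).
have [d0|d0] := posnP d; first exact: (depth_matched_degree_one du dv u0 v0 uq uv d0).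
have uq1 := u_head du dv u0 v0 uq uv.
have qn : q.+1 < n.+1 by rewrite ltnS; apply: q_lt_max dv v0.
pose r := Ordinal qn; have rq : r = q.+1 :> nat by [].
have [ur|ur] := posnP (u r); last exact: (depth_matched_next_var du dv u0 v0 uq uv rq ur).
have [rv|[j [vj jv]]] := lex_ge_total (U_(r) *+ d + U_(ord_max))%MM v.
  exact: (depth_matched_small_v du dv u0 v0 uq uv d0 rq ur rv).
have [l0 l0P] : exists l : 'I_n.+1, (q < l) && (0 < u l).
  have [|i] := @mdeg_gt0 _ (u - U_(q))%MM.
    by have := du; rewrite -{1}(submUK uq) mdegD mdeg1; lia.
  rewrite mnmBE mnm1E; have [<-|qi ui] := eqVneq q i; first by rewrite uq1.
  exists i; rewrite -[u i]subn0 ui andbT ltn_neqAle qi leqNgt.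
  by apply/negP => /u0 ui0; rewrite ui0 in ui.
case: (@arg_minnP _ l0 (fun l => (q < l) && (0 < u l)) val l0P) => l /andP[ql ul] lmin.
have l_min (k : 'I_n.+1) : q < k -> k < l -> u k = 0.
  move=> qk kl; apply/eqP; rewrite eqn0Ngt; apply/negP => uk.
  by have := lmin k; rewrite qk uk /= leqNgt kl => /(_ isT).
have rl : r < l.
  rewrite ltn_neqAle ql andbT; apply/eqP => /val_inj E; rewrite -E ur // in ul.
have rj : r <= j.
  by rewrite ltnNge; apply/negP => /v0 E; rewrite E in jv.
have rn : r < @ord_max n by apply: leq_trans rl (leq_ord l).
have vE (i : 'I_n.+1) : U_(r)%MM i * d + U_(i)%MM i <= v i -> d <= v r ->
    v = (U_(r) *+ d + U_(i))%MM.
  move=> vi vr; symmetry; apply: lepm_mdeg_eq; last first.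
    by rewrite dv mdegD mdegMn !mdeg1 mul1n addn1.
  apply/mnm_lepP => k; rewrite mnmDE mulmnE.
  have [<-//|ik] := eqVneq i k.
  rewrite [U_(i)%MM k]mnm1E (negPf ik) addn0 mnm1E.
  by have [<-|_] := eqVneq r k; rewrite ?mul1n.
move: jv; rewrite mnmDE mulmnE; have [->|jr] := eqVneq j r => jv.
  rewrite (mnm1_lt rn) mnm1E eqxx mul1n addn0 in jv.
  apply: (depth_matched_large_v du dv u0 v0 uq uv d0 rq ur (leqnn r) rn _ rl ul l_min) => //.
  by apply: vE; rewrite ?mnm1E ?eqxx ?mul1n ?addn1 // ltnW.
have {}rj : r < j by rewrite ltn_neqAle eq_sym jr.
have vr : v r = d by rewrite vj // mnmDE mulmnE (mnm1_lt rn) mnm1E eqxx mul1n addn0.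
have rj' : U_(r)%MM j = 0 by rewrite mnm1E eq_sym (negPf jr).
have vrj : v r + v j <= d.+1 by rewrite -dv mdeg_ge2 // eq_sym.
have jn : j < @ord_max n.
  rewrite ltnNge; apply/negP => nj; have jE : j = ord_max.
    by apply/val_inj/eqP; rewrite eqn_leq nj leq_ord.
  by move: jv vrj; rewrite rj' jE mnm1E eqxx vr; lia.
apply: (depth_matched_large_v du dv u0 v0 uq uv d0 rq ur (ltnW rj) jn _ rl ul l_min) => //.
by apply: vE; rewrite ?vr // rj' mnm1E eqxx; lia.
Qed.

(** Induction on the degree.  If u = v, every variable of u divides the only
    generator.  Otherwise let q be the first index where u and v differ.  Up to q
    the exponents of every generator are at least those of v, so a variable of v
    of index at most q can be divided out; if there is none, the segment is
    normalized. *)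
Theorem depth_matched_lexset n d (u v : 'X_{1..n.+1}) :
  mdeg u = d.+1 -> mdeg v = d.+1 -> lex_ge u v ->
  depth_matched (lexset d.+1 u v).
Proof.
elim: d u v => [|d IH] u v du dv uv.
  have /mdeg1P[i /eqP uE] : mdeg u == 1 by rewrite du.
  have /mdeg1P[j /eqP vE] : mdeg v == 1 by rewrite dv.
  have [E|ij] := eqVneq i j.
    have -> : lexset 1 u v = (fun g => g = U_(i)%MM); last exact: depth_matched_var.
    apply/funext => g; apply/propext; rewrite uE vE -E.
    by split=> [[_ ug gu]|->]; [apply: lex_ge_anti | split; rewrite ?mdeg1 //; left].
  apply: (@depth_matched_normalized _ _ _ _ i) => //.
  - by move=> k ki; rewrite uE mnm1_lt.
  - move=> k ki; rewrite vE mnm1_lt //; apply: leq_ltn_trans ki _.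
    by rewrite ltn_neqAle ij; apply/lex_geU; rewrite -uE -vE.
  - by rewrite uE mnm1E eqxx.
have peel (i : 'I_n.+1) : 0 < u i -> 0 < v i ->
    (forall g, lexset d.+2 u v g -> 0 < g i) -> depth_matched (lexset d.+2 u v).
  move=> ui vi; move: du dv uv; rewrite -(submUK ui) -(submUK vi).
  rewrite !mdegD !mdeg1 !addn1 => -[du'] [dv'] /lex_geD2r uv' gi.
  rewrite lexset_shift //; apply: depth_matched_shift.
  exact: IH.
case: (uv) => [E|[q [uvq vq]]].
  have [i ui] : exists i, 0 < u i by apply: mdeg_gt0; rewrite du.
  apply: (peel i) => //; first by rewrite -E.
  by move=> g [_ ug gv]; rewrite (lex_ge_anti gv _) -?E.
have [/existsP[i /andP[iq vi]]|] := boolP [exists i : 'I_n.+1, (i <= q) && (0 < v i)].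
  have ui : v i <= u i.
    by apply: lex_ge_coord uv _ => k ki; apply: uvq; apply: leq_trans ki iq.
  apply: (peel i) => // [|g Lg]; first exact: leq_trans ui.
  apply: leq_trans vi _; have [_ _ gv] := Lg; apply: lex_ge_coord gv _ => k ki.
  exact: lexset_common_prefix Lg uvq _ (leq_trans ki iq).
rewrite negb_exists => /forallP vq0.
have v0 (k : 'I_n.+1) : k <= q -> v k = 0.
  by move=> kq; have := vq0 k; rewrite kq -eqn0Ngt => /eqP.
apply: (@depth_matched_normalized _ _ _ _ q) => //.
- by move=> k kq; rewrite uvq // v0 // ltnW.
- exact: leq_ltn_trans vq.
Qed.

Theorem corollary3p9 (K : fieldType) (n d : nat) (u v : 'X_{1..n}) :
  (2 <= d)%N -> mdeg u = d -> mdeg v = d -> lex_ge u v ->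
  (depth (quot_mod (lexsegment K d u v)) <=
   sdepth (quot_mod (lexsegment K d u v)) (quot_gr (lexsegment K d u v)))%N.
Proof.
case: n u v => [|n] u v; first by move=> d2 du; rewrite mdegE big_ord0 in du; rewrite -du in d2.
case: d => // d _ du dv uv.
have GE (f : {mpoly K[n.+1]}) : lexsegment K d.+1 u v f <->
    exists2 g, lexset d.+1 u v g & f = mpolyX _ g.
  by split=> [[g [dg ug gv ->]]|[g [dg ug gv] ->]]; exists g.
have [w [Y [wL wY _ bp]]] := depth_matched_lexset du dv uv.
apply: (@leq_trans (n.+1 - #|Y|)).
  rewrite leq_subRL; last by have := max_card (mem Y); rewrite card_ord.
  by rewrite addnC; apply: (depth_le GE wL wY).
by apply: (sdepth_ge GE _ bp); rewrite leq_subr.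
Qed.
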